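(* There is a polynomial-time $4$-approximation algorithm for the colored token swapping problem on general connected graphs, and a polynomial-time $2$-approximation algorithm for the colored token swapping problem on trees.
   Context: Colored token swapping problem: we are given a connected undirected graph $G$ with $n$ vertices; every vertex has a color and carries exactly one token, and every token also has a color, such that for each color the number of tokens of that color equals the number of vertices of that color. A swap exchanges the tokens on the two endpoints of an edge of $G$. The goal is to find a shortest sequence of swaps after which every token lies on a vertex of its own color. (If all colors are distinct, this is the ordinary token swapping problem, where each token must reach its unique target vertex.) An $\alpha$-approximation algorithm outputs a valid swap sequence whose length is at most $\alpha$ times the minimum possible. *)

(* Defs.v *)
From mathcomp Require Import all_boot fingroup perm.
Set Implicit Arguments.
Unset Strict Implicit.
Unset Printing Implicit Defensive.

(** * Model of computation: a random access machine with logarithmic cost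

    The memory consists of arrays of natural numbers, both the arrays and their
    cells being indexed by [nat]; a program can name only finitely many arrays,
    and a scalar variable is cell 0 of an array.  Programs are structured
    (while-programs) and every operation is charged the bit lengths of the
    numbers it handles, so that polynomial time here is polynomial time on
    Turing machines. *)

Definition store := nat -> nat -> nat.

Definition update (s : store) (a i v : nat) : store :=
  fun b j => if (b == a) && (j == i) then v else s b j.

(* [ESub] is truncated subtraction. *)
Inductive expr : Type :=
| EConst of nat
| EGet of nat & expr
| EAdd of expr & expr
| ESub of expr & expr
| EMul of expr & expr.

Inductive cmd : Type :=
| CSkip
| CPut of nat & expr & expr
| CSeq of cmd & cmd
| CIf of expr & cmd & cmd
| CWhile of expr & cmd.

Fixpoint eval (s : store) (e : expr) : nat :=
  match e with
  | EConst n => n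
  | EGet a e1 => s a (eval s e1)
  | EAdd e1 e2 => eval s e1 + eval s e2
  | ESub e1 e2 => eval s e1 - eval s e2
  | EMul e1 e2 => eval s e1 * eval s e2
  end.

(* Length of the binary representation, with one digit for 0. *)
Definition bitlen (n : nat) : nat := (trunc_log 2 n).+1.

(* The bit length of every intermediate value is charged once, including the
   addresses of memory accesses. *)
Fixpoint ecost (s : store) (e : expr) : nat :=
  bitlen (eval s e) +
  match e with
  | EConst _ => 0
  | EGet _ e1 => ecost s e1
  | EAdd e1 e2 | ESub e1 e2 | EMul e1 e2 => ecost s e1 + ecost s e2
  end.

(* [exec s c t s']: started in [s], the program [c] halts in [s'] at total
   cost [t].  Guards are true when they are nonzero. *)
Inductive exec : store -> cmd -> nat -> store -> Prop :=
| exec_skip s : exec s CSkip 1 s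
| exec_put s a ei ev :
    exec s (CPut a ei ev) (ecost s ei + ecost s ev)
      (update s a (eval s ei) (eval s ev))
| exec_seq s c1 t1 s1 c2 t2 s2 :
    exec s c1 t1 s1 -> exec s1 c2 t2 s2 ->
    exec s (CSeq c1 c2) (t1 + t2) s2
| exec_if_true s e c1 c2 t s' :
    eval s e != 0 -> exec s c1 t s' ->
    exec s (CIf e c1 c2) (ecost s e + t) s'
| exec_if_false s e c1 c2 t s' :
    eval s e = 0 -> exec s c2 t s' ->
    exec s (CIf e c1 c2) (ecost s e + t) s'
| exec_while_true s e c t1 s1 t2 s2 :
    eval s e != 0 -> exec s c t1 s1 -> exec s1 (CWhile e c) t2 s2 ->
    exec s (CWhile e c) (ecost s e + t1 + t2) s2
| exec_while_false s e c :
    eval s e = 0 -> exec s (CWhile e c) (ecost s e) s.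

(* The input, preceded by its number of words, is placed in array 0; all the
   other cells are 0. *)
Definition init_store (w : seq nat) : store :=
  fun a i => if a == 0 then nth 0 (size w :: w) i else 0.

(* The output is read from array 1, again preceded by its number of words. *)
Definition output (s : store) : seq nat :=
  mkseq (fun i => s 1 i.+1) (s 1 0).

Definition input_size (w : seq nat) : nat := \sum_(x <- w) bitlen x.

(* On the encoding of every [x] satisfying [dom], the program [p] halts within
   time polynomial in the input size, with an output correct for [x]. *)
Definition poly_time_solves (T : Type) (enc : T -> seq nat) (dom : T -> Prop)
    (correct : T -> seq nat -> Prop) (p : cmd) : Prop :=
  exists c d : nat, forall x : T, dom x ->
    exists t s, [/\ exec (init_store (enc x)) p t s,
      t <= c * input_size (enc x) ^ d + c & correct x (output s)].

(** * Graphs *)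

Record sgraph := SGraph {
  nvert : nat;
  adj : rel 'I_nvert;
  adj_sym : symmetric adj;
  adj_irr : irreflexive adj
}.

Definition connected (G : sgraph) : Prop :=
  forall u v : 'I_(nvert G), connect (@adj G) u v.

(* Walking back and forth along an edge is a [ucycle] of size 2, whence the
   lower bound on the size. *)
Definition acyclic (G : sgraph) : Prop :=
  forall c : seq 'I_(nvert G), 2 < size c -> ~ ucycle (@adj G) c.

Definition is_tree (G : sgraph) : Prop := connected G /\ acyclic G.

(** * Colored token swapping *)

(* Tokens are named after the vertices that carry them initially: [tcol v] is
   the color of the token initially on [v]. *)
Record cts_instance := CTSInstance {
  graph : sgraph;
  graph_conn : connected graph;
  vcol : 'I_(nvert graph) -> nat;
  tcol : 'I_(nvert graph) -> nat;
  col_balanced : forall k : nat,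
    #|[set v | tcol v == k]| = #|[set v | vcol v == k]|
}.

Section Swaps.

Variable I : cts_instance.
Let V : finType := 'I_(nvert (graph I)).

(* A placement maps each vertex to the token it carries. *)
Definition swap (f : V -> V) (e : V * V) : V -> V :=
  fun v => f (tperm e.1 e.2 v).

Definition placement_after (sw : seq (V * V)) : V -> V := foldl swap id sw.

Definition valid_swaps (sw : seq (V * V)) : Prop :=
  all (fun e => @adj (graph I) e.1 e.2) sw /\
  forall v, tcol (placement_after sw v) = vcol v.

Definition is_min_length (m : nat) : Prop :=
  (exists2 sw, valid_swaps sw & size sw = m) /\
  forall sw, valid_swaps sw -> m <= size sw.

Definition encode_swaps (sw : seq (V * V)) : seq nat :=
  flatten [seq [:: val e.1; val e.2] | e <- sw].

(* Number of vertices, adjacency matrix in row-major order, vertex colors,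
   token colors. *)
Definition encode_instance : seq nat :=
  nvert (graph I) ::
    [seq nat_of_bool (@adj (graph I) u v) | u <- enum V, v <- enum V] ++
    [seq vcol v | v <- enum V] ++ [seq tcol v | v <- enum V].

Definition approx_solution (alpha : nat) (out : seq nat) : Prop :=
  exists sw : seq (V * V), [/\ out = encode_swaps sw, valid_swaps sw &
    forall m, is_min_length m -> size sw <= alpha * m].

End Swaps.

Definition poly_time_approx (alpha : nat) (P : sgraph -> Prop) : Prop :=
  exists p : cmd,
    poly_time_solves encode_instance (fun I => P (graph I))
      (fun I => @approx_solution I alpha) p.

(* Main.v *)
Require Import Defs.
From mathcomp Require Import all_boot fingroup perm zify.
Set Implicit Arguments.
Unset Strict Implicit.
Unset Printing Implicit Defensive.

(** All-pairs distances and next hops are computed by relaxation.  A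
    color-respecting assignment [f] of targets to tokens that minimises the
    total distance is found by an auction: an unassigned token [u] takes the
    target [x] of its color minimising [(n + 1) * d u x + price x], evicts the
    previous owner and raises the price of [x] by 1.  At the end every token is
    within 1 of its best offer, so that [(n + 1) * (total distance)] is within
    [n] of its minimum, hence minimal.  A swap changes the total distance by at
    most 2, so the total distance of [f] is at most twice the optimum.

    On general graphs a permutation cycle is resolved by transpositions between
    consecutive vertices of the cycle, each made of [2 * d - 1] swaps along a
    shortest path of length [d]; one edge of the cycle is saved.  This takes at
    most twice the total distance.  On trees one swaps [u] and [v] when the
    token on [u] wants to go to [v] and the token on [v] either is at home or
    wants to go to [u].  Such a pair exists, because following the wishes of the
    tokens would otherwise lead to a cycle of the graph, and the swap decreases
    the total distance plus the number of cycles of the permutation. *)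

(** * Bit lengths and polynomial bounds *)

Lemma bitlen_le (x b : nat) : 0 < b -> (bitlen x <= b) = (x < 2 ^ b).
Proof.
move=> b0; rewrite /bitlen; case: (ltnP x (2 ^ b)) => hx.
  case: (posnP x) => [->|x0]; first by rewrite trunc_log0.
  have [h _] := andP (trunc_log_bounds (isT : 1 < 2) x0).
  by rewrite -(ltn_exp2l _ _ (isT : 1 < 2)); apply: leq_ltn_trans h hx.
by apply/negbTE; rewrite -leqNgt trunc_log_max.
Qed.

Lemma ltn_exp_bitlen (x : nat) : x < 2 ^ bitlen x.
Proof. by rewrite -bitlen_le. Qed.

Lemma bitlen_mono (x y : nat) : x <= y -> bitlen x <= bitlen y.
Proof. by move=> h; rewrite /bitlen ltnS leq_trunc_log. Qed.

Lemma bitlen_mul (x y : nat) : bitlen (x * y) <= bitlen x + bitlen y.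
Proof.
rewrite bitlen_le ?addn_gt0 // expnD.
by apply: ltn_mul; apply: ltn_exp_bitlen.
Qed.

Lemma bitlen_add (x y : nat) : bitlen (x + y) <= bitlen x + bitlen y.
Proof.
rewrite bitlen_le ?addn_gt0 // expnD.
have h a : 2 <= 2 ^ bitlen a by rewrite -{1}(expn1 2) leq_exp2l.
have := (ltn_exp_bitlen x, ltn_exp_bitlen y, h x, h y).
by move: (2 ^ _) (2 ^ _) => a b [[[]]]; nia.
Qed.

Lemma bitlen_leS (x : nat) : bitlen x <= x.+1.
Proof. by rewrite bitlen_le //; apply/ltnW/ltn_expl. Qed.

(** One constant serves as shift and as exponent, so closure under sums and products only enlarges
    it; [poly_boundedP] converts to the usual form at the end. *)
Definition poly_bounded (f : nat -> nat) := exists c, forall n, f n <= (n + c) ^ c.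

Lemma leq_shift_exp (n a b c d : nat) :
  a <= b -> 0 < b -> c <= d -> (n + a) ^ c <= (n + b) ^ d.
Proof.
move=> ab b0 cd; have h : 0 < n + b by lia.
apply: leq_trans (leq_pexp2l h cd); case: (posnP c) => [->|c0]; first by [].
by rewrite leq_exp2r // leq_add2l.
Qed.

Lemma poly_bounded_const (k : nat) : poly_bounded (fun=> k).
Proof.
exists k.+1 => n; apply: (@leq_trans ((n + k.+1) ^ 1)); first by rewrite expn1; lia.
by apply: leq_shift_exp.
Qed.

Lemma poly_bounded_id : poly_bounded id.
Proof. by exists 1 => n; rewrite expn1 addn1 leqnSn. Qed.

Lemma poly_bounded_mul (f g : nat -> nat) :
  poly_bounded f -> poly_bounded g -> poly_bounded (fun n => f n * g n).
Proof.
move=> [c hc] [d hd]; exists (c + d).+1 => n.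
apply: (leq_trans (leq_mul (hc n) (hd n))).
apply: (@leq_trans ((n + (c + d).+1) ^ c * (n + (c + d).+1) ^ d)).
  by apply: leq_mul; apply: leq_shift_exp; lia.
by rewrite -expnD; apply: leq_shift_exp; lia.
Qed.

Lemma poly_bounded_add (f g : nat -> nat) :
  poly_bounded f -> poly_bounded g -> poly_bounded (fun n => f n + g n).
Proof.
move=> [c hc] [d hd]; exists (c + d).+2 => n.
apply: (leq_trans (leq_add (hc n) (hd n))).
apply: (@leq_trans (2 * (n + (c + d).+2) ^ (c + d).+1)).
  by rewrite mul2n -addnn; apply: leq_add; apply: leq_shift_exp; lia.
by rewrite (expnS _ (c + d).+1); apply: leq_mul; lia.
Qed.

Lemma poly_boundedP (f : nat -> nat) :
  poly_bounded f -> exists c d, forall n, f n <= c * n ^ d + c.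
Proof.
move=> [c hc]; exists (c.+1 ^ c), c => n; apply: (leq_trans (hc n)).
case: n => [|n]; first by rewrite add0n (leq_trans _ (leq_addl _ _)) //;
  by case: (posnP c) => [->//|c0]; rewrite leq_exp2r.
apply: leq_trans (leq_addr _ _); rewrite -expnMn.
by case: (posnP c) => [->//|c0]; rewrite leq_exp2r //; nia.
Qed.

(** * Programs with counted loops *)

(** With counted loops only, [run] is a total function on stores, and correctness is proved about it
    instead of about [exec]. *)
Inductive prog : Type :=
| PPut of nat & expr & expr
| PSeq of prog & prog
| PWhen of expr & prog
| PFor of nat & expr & prog.

Notation cell a := (EGet a (EConst 0)).

(** The guard re-evaluates [e] at every turn, while [run] evaluates it once on entry. They agree
    under [wf]: a static bound reads only array 0, which is never written, and the body leaves the
    counter alone. *)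
Fixpoint compile (p : prog) : cmd :=
  match p with
  | PPut a ei ev => CPut a ei ev
  | PSeq p q => CSeq (compile p) (compile q)
  | PWhen e p => CIf e (compile p) CSkip
  | PFor i e p =>
      CSeq (CPut i (EConst 0) (EConst 0))
        (CWhile (ESub e (cell i))
          (CSeq (compile p) (CPut i (EConst 0) (EAdd (cell i) (EConst 1)))))
  end.

Definition tick (i : nat) (s : store) : store := update s i 0 (s i 0 + 1).

Arguments update : simpl never.
Arguments tick : simpl never.

Fixpoint run (p : prog) (s : store) : store :=
  match p with
  | PPut a ei ev => update s a (eval s ei) (eval s ev)
  | PSeq p q => run q (run p s)
  | PWhen e p => if eval s e != 0 then run p s else s
  | PFor i e p => iter (eval s e) (fun s' => tick i (run p s')) (update s i 0 0)
  end.

Fixpoint writes (p : prog) (a : nat) : bool :=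
  match p with
  | PPut b _ _ => a == b
  | PSeq p q => writes p a || writes q a
  | PWhen _ p => writes p a
  | PFor i _ p => (a == i) || writes p a
  end.

(* Loop bounds are polynomials in cell 1 of array 0, the number of vertices. *)
Fixpoint static (e : expr) : bool :=
  match e with
  | EConst _ => true
  | EGet 0 (EConst 1) => true
  | EAdd e1 e2 | EMul e1 e2 => static e1 && static e2
  | _ => false
  end.

Fixpoint static_val (n : nat) (e : expr) : nat :=
  match e with
  | EConst k => k
  | EGet _ _ => n
  | EAdd e1 e2 => static_val n e1 + static_val n e2
  | EMul e1 e2 => static_val n e1 * static_val n e2
  | ESub e1 _ => static_val n e1
  end.

(* Storing the value of a slow expression raises the maximum of the memory by
   at most 2, so that values have polynomial bit length. *)
Fixpoint slow (e : expr) : bool :=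
  match e with
  | EConst k => k <= 2
  | EGet _ _ => true
  | EAdd (EGet _ _) (EConst k) => k <= 2
  | ESub e1 _ => slow e1
  | _ => false
  end.

Fixpoint wf (p : prog) : bool :=
  match p with
  | PPut a _ ev => (a != 0) && slow ev
  | PSeq p q => wf p && wf q
  | PWhen _ p => wf p
  | PFor i e p => [&& i != 0, static e, ~~ writes p i & wf p]
  end.

(** An upper bound on the number of assignments executed, loop counters included. Since each raises
    the memory maximum by at most 2, it controls the size of all cells. *)
Fixpoint puts (p : prog) (n : nat) : nat :=
  match p with
  | PPut _ _ _ => 1
  | PSeq p q => puts p n + puts q n
  | PWhen _ p => puts p n
  | PFor _ e p => 1 + static_val n e * (puts p n + 1)
  end.

(** [value_weight], [weight] and [work] are factors of a common bound [b] on the bit lengths of the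
    memory cells: for the value of an expression, for its cost, and for the running time of a
    program. *)
Fixpoint value_weight (e : expr) : nat :=
  match e with
  | EConst k => bitlen k
  | EGet _ _ => 1
  | EAdd e1 e2 | EMul e1 e2 => value_weight e1 + value_weight e2
  | ESub e1 _ => value_weight e1
  end.

Fixpoint weight (e : expr) : nat :=
  value_weight e +
  match e with
  | EConst _ => 0
  | EGet _ e1 => weight e1
  | EAdd e1 e2 | ESub e1 e2 | EMul e1 e2 => weight e1 + weight e2
  end.

Fixpoint work (p : prog) (n : nat) : nat :=
  match p with
  | PPut _ ei ev => weight ei + weight ev
  | PSeq p q => work p n + work q n
  | PWhen e p => weight e + (work p n + 1)
  | PFor i e p =>
      weight (EConst 0) + weight (EConst 0) + weight (ESub e (cell i)) +
      static_val n e *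
        (weight (ESub e (cell i)) + work p n +
         (weight (EConst 0) + weight (EAdd (cell i) (EConst 1))))
  end.

Definition cells_le (M : nat) (s : store) : Prop := forall a j, s a j <= M.

Lemma eval_static (s : store) (n : nat) (e : expr) :
  s 0 1 = n -> static e -> eval s e = static_val n e.
Proof.
move=> sn; elim: e => //= [a e _|e1 h1 e2 h2|e1 h1 e2 h2].
- by case: a => //; case: e => //; case=> //; case.
- by move=> /andP[/h1-> /h2->].
- by move=> /andP[/h1-> /h2->].
Qed.

Lemma eval_slow (s : store) (M : nat) (e : expr) :
  cells_le M s -> slow e -> eval s e <= M + 2.
Proof.
move=> hs; elim: e => //=; try by move=> *; lia.
- by move=> a e _ _; have := hs a (eval s e); lia.
- by move=> [] // a e1 _ [] // k _ hk /=; have := hs a (eval s e1); lia.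
Qed.

Lemma bitlen_eval (s : store) (M b : nat) (e : expr) :
  cells_le M s -> bitlen M <= b -> bitlen (eval s e) <= value_weight e * b.
Proof.
move=> hs hb; have b0 : 0 < b by apply: leq_trans hb.
elim: e => /= [k|a e _|e1 h1 e2 h2|e1 h1 e2 h2|e1 h1 e2 h2].
- by rewrite leq_pmulr.
- by rewrite mul1n; apply: leq_trans hb; apply: bitlen_mono.
- by have := bitlen_add (eval s e1) (eval s e2); rewrite mulnDl; lia.
- by apply: leq_trans h1; apply: bitlen_mono; apply: leq_subr.
- by have := bitlen_mul (eval s e1) (eval s e2); rewrite mulnDl; lia.
Qed.

Lemma ecost_le (s : store) (M b : nat) (e : expr) :
  cells_le M s -> bitlen M <= b -> ecost s e <= weight e * b.
Proof.
move=> hs hb; have hv := bitlen_eval _ hs hb.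
elim: e => /= [k|a e h|e1 h1 e2 h2|e1 h1 e2 h2|e1 h1 e2 h2]; rewrite mulnDl.
- by have := hv (EConst k) => /=; lia.
- by have := hv (EGet a e) => /=; lia.
- by have := hv (EAdd e1 e2) => /=; lia.
- by have := hv (ESub e1 e2) => /=; lia.
- by have := hv (EMul e1 e2) => /=; lia.
Qed.

Arguments weight : simpl never.

Lemma updateE (s : store) (a i v b j : nat) :
  update s a i v b j = if (b == a) && (j == i) then v else s b j.
Proof. by []. Qed.

Lemma tick_neq (s : store) (i a j : nat) : a != i -> tick i s a j = s a j.
Proof. by rewrite /tick updateE => /negbTE->. Qed.

Lemma tick_eq (s : store) (i : nat) : tick i s i 0 = (s i 0).+1.
Proof. by rewrite /tick updateE !eqxx addn1. Qed.

Lemma update_cells (s : store) (M a i v : nat) :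
  cells_le M s -> v <= M -> cells_le M (update s a i v).
Proof. by move=> hs hv b j; rewrite updateE; case: ifP. Qed.

Lemma run_frame (p : prog) (s : store) (a j : nat) :
  ~~ writes p a -> run p s a j = s a j.
Proof.
elim: p s => [b ei ev|p hp q hq|e p hp|i e p hp] s /=.
- by rewrite updateE => /negbTE->.
- by rewrite negb_or => /andP[h1 h2]; rewrite hq // hp.
- by move=> h; case: ifP => // _; rewrite hp.
- rewrite negb_or => /andP[h1 h2].
  by elim: (eval s e) => [|k IH] /=; rewrite ?tick_neq ?hp // updateE (negbTE h1).
Qed.

Lemma wf_writes0 (p : prog) : wf p -> ~~ writes p 0.
Proof.
elim: p => //= [a ei ev|p hp q hq|i e p hp].
- by rewrite eq_sym => /andP[].
- by move=> /andP[/hp h1 /hq h2]; rewrite negb_or h1.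
- by rewrite eq_sym negb_or => /and4P[-> _ _ /hp].
Qed.

Lemma cells_leW (M N : nat) (s : store) : M <= N -> cells_le M s -> cells_le N s.
Proof. by move=> h hs a j; apply: leq_trans (hs a j) h. Qed.

Lemma run_cells (p : prog) (n M : nat) (s : store) :
  wf p -> s 0 1 = n -> cells_le M s -> cells_le (M + 2 * puts p n) (run p s).
Proof.
elim: p s M => [b ei ev|p hp q hq|e p hp|i e p hp] s M /=.
- move=> /andP[_ hv] _ hs; rewrite muln1; apply: update_cells.
    by apply: cells_leW hs; lia.
  exact: eval_slow.
- move=> /andP[wp wq] sn hs; rewrite mulnDr addnA; apply: hq => //; last exact: hp.
  by rewrite run_frame ?wf_writes0.
- move=> wp sn hs; case: ifP => _; first exact: hp.
  by apply: cells_leW hs; lia.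
- move=> /and4P[i0 se wi wp] sn hs; rewrite (eval_static sn se).
  have h k : let s' := iter k (fun s' => tick i (run p s')) (update s i 0 0) in
      s' 0 1 = n /\ cells_le (M + 2 * (1 + k * (puts p n + 1))) s'.
    elim: k => [|k [IH1 IH2]] /=.
      split; first by rewrite updateE eq_sym (negbTE i0).
      by apply: update_cells => //; apply: cells_leW hs; lia.
    split; first by rewrite tick_neq ?run_frame ?wf_writes0 // eq_sym.
    have := hp _ _ wp IH1 IH2; move: (run p _) => s' hs'.
    apply: update_cells; first by apply: cells_leW hs'; lia.
    by have := hs' i 0; lia.
  by have [] := h (static_val n e).
Qed.

(** Every cell met during the run is at most [M + 2 * puts p n], of bit length at most [b], so each
    evaluation costs at most its weight times [b]. *)
Lemma exec_compile (p : prog) (n M b : nat) (s : store) :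
  wf p -> s 0 1 = n -> cells_le M s -> bitlen (M + 2 * puts p n) <= b ->
  exists2 t, exec s (compile p) t (run p s) & t <= work p n * b.
Proof.
elim: p s M => [a ei ev|p hp q hq|e p hp|i e p hp] s M /=.
- move=> _ sn hs hb; eexists; first exact: exec_put.
  have hM : bitlen M <= b by apply: leq_trans hb; apply: bitlen_mono; lia.
  by rewrite mulnDl leq_add // (ecost_le _ hs).
- move=> /andP[wp wq] sn hs hb.
  have [|t1 e1 l1] := hp s M wp sn hs.
    by apply: leq_trans hb; apply: bitlen_mono; lia.
  have [| | |t2 e2 l2] := hq (run p s) (M + 2 * puts p n) wq.
  - by rewrite run_frame ?wf_writes0.
  - exact: run_cells.
  - by apply: leq_trans hb; apply: bitlen_mono; lia.
  by exists (t1 + t2); [apply: exec_seq e2 | rewrite mulnDl leq_add].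
- move=> wp sn hs hb; have [t e1 l1] := hp s M wp sn hs hb.
  have hM : bitlen M <= b by apply: leq_trans hb; apply: bitlen_mono; lia.
  have he := ecost_le e hs hM.
  case: (eqVneq (eval s e) 0) => [z|z] /=.
    exists (ecost s e + 1); first exact: exec_if_false z (exec_skip s).
    have b0 : 0 < b by apply: leq_trans hb.
    by rewrite !mulnDl; lia.
  exists (ecost s e + t); first exact: exec_if_true z e1.
  by rewrite !mulnDl; lia.
- move=> /and4P[i0 se wi wp] sn hs hb.
  set N := static_val n e in hb *; set g := ESub e (cell i).
  set body := CSeq (compile p) _.
  have b0 : 0 < b by apply: leq_trans hb.
  (* Induction on the number [k] of turns left; the counter holds the number of turns done and
     thereby bounds the growth of the memory so far. *)
  have loop k s' : s' 0 1 = n -> s' i 0 + k = N ->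
      cells_le (M + 2 * (1 + s' i 0 * (puts p n + 1))) s' ->
      exists2 t, exec s' (CWhile g body) t (iter k (fun s' => tick i (run p s')) s') &
        t <= (weight g + k * (weight g + work p n +
               (weight (EConst 0) + weight (EAdd (cell i) (EConst 1))))) * b.
    elim: k s' => [|k IH] s' sn' hk hs'.
      exists (ecost s' g).
        by apply: exec_while_false; rewrite /= (eval_static sn' se) -/N; lia.
      rewrite mul0n addn0; apply: (ecost_le _ hs').
      apply: leq_trans hb; apply: bitlen_mono.
      by rewrite leq_add2l leq_mul2l /= leq_add2l leq_mul2r; lia.
    have kN : s' i 0 < N by lia.
    have h2 : (s' i 0).+1 * (puts p n + 1) <= N * (puts p n + 1).
      by rewrite leq_mul2r kN orbT.
    have [|t1 e1 l1] := hp s' _ wp sn' hs'.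
      by apply: leq_trans hb; apply: bitlen_mono; lia.
    have ri : run p s' i 0 = s' i 0 by apply: run_frame.
    have hs1 := run_cells wp sn' hs'.
    have [| | |t2 e2 l2] := IH (tick i (run p s')).
    - by rewrite tick_neq ?run_frame ?wf_writes0 // eq_sym.
    - by rewrite tick_eq ri; lia.
    - rewrite tick_eq ri; apply: update_cells; rewrite ?ri; last by nia.
      by apply: cells_leW hs1; lia.
    have hM' : bitlen (M + 2 * (1 + s' i 0 * (puts p n + 1))) <= b.
      by apply: leq_trans hb; apply: bitlen_mono; lia.
    have hM1 : bitlen (M + 2 * (1 + s' i 0 * (puts p n + 1)) + 2 * puts p n) <= b.
      by apply: leq_trans hb; apply: bitlen_mono; lia.
    exists (ecost s' g + (t1 + (ecost (run p s') (EConst 0) +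
        ecost (run p s') (EAdd (cell i) (EConst 1)))) + t2).
      rewrite iterSr; apply: exec_while_true e2.
        by rewrite /= (eval_static sn' se) -/N; lia.
      by apply: exec_seq e1 _; apply: exec_put.
    have c1 := ecost_le g hs' hM'.
    have c2 := ecost_le (EConst 0) hs1 hM1.
    have c3 := ecost_le (EAdd (cell i) (EConst 1)) hs1 hM1.
    rewrite mulSn; move: c1 c2 c3 l1 l2.
    move: (weight _) (weight _) (weight _) (ecost _ _) (ecost _ _) (ecost _ _).
    by move=> w1 w2 w3 a1 a2 a3; rewrite !mulnDl; lia.
  rewrite (eval_static sn se) -/N.
  have [| | |t e1 l1] := loop N (update s i 0 0).
  - by rewrite updateE eq_sym (negbTE i0).
  - by rewrite updateE !eqxx.
  - by rewrite updateE !eqxx /=; apply: update_cells => //; apply: cells_leW hs; lia.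
  have hM : bitlen M <= b by apply: leq_trans hb; apply: bitlen_mono; lia.
  eexists; first by apply: exec_seq e1; apply: exec_put.
  have c := ecost_le (EConst 0) hs hM.
  by move: c l1; rewrite !mulnDl; lia.
Qed.

Lemma poly_bounded_static (e : expr) : poly_bounded (static_val^~ e).
Proof.
elim: e => [k|a e _|e1 h1 e2 h2|e1 h1 e2 h2|e1 h1 e2 h2] /=.
- exact: poly_bounded_const.
- exact: poly_bounded_id.
- exact: poly_bounded_add.
- exact: h1.
- exact: poly_bounded_mul.
Qed.

Lemma poly_bounded_puts (p : prog) : poly_bounded (puts p).
Proof.
elim: p => [a ei ev|p hp q hq|e p hp|i e p hp] /=.
- exact: poly_bounded_const.
- exact: poly_bounded_add.
- exact: hp.
- apply: poly_bounded_add; first exact: poly_bounded_const.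
  apply: poly_bounded_mul; first exact: poly_bounded_static.
  by apply: poly_bounded_add => //; apply: poly_bounded_const.
Qed.

Lemma poly_bounded_work (p : prog) : poly_bounded (work p).
Proof.
elim: p => [a ei ev|p hp q hq|e p hp|i e p hp].
- exact: poly_bounded_const.
- exact: poly_bounded_add.
- apply: poly_bounded_add; first exact: poly_bounded_const.
  by apply: poly_bounded_add => //; apply: poly_bounded_const.
- apply: poly_bounded_add; first exact: poly_bounded_const.
  apply: poly_bounded_mul; first exact: poly_bounded_static.
  apply: poly_bounded_add; last exact: poly_bounded_const.
  by apply: poly_bounded_add => //; apply: poly_bounded_const.
Qed.

Lemma size_le_input_size (w : seq nat) : size w <= input_size w.
Proof.
rewrite /input_size -sum1_size; exact: leq_sum.
Qed.

Lemma init_cells (w : seq nat) : cells_le (2 ^ input_size w) (init_store w).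
Proof.
move=> a i; rewrite /init_store; case: ifP => // _; case: i => [|i] /=.
  by apply: leq_trans (size_le_input_size w) _; apply/ltnW/ltn_expl.
case: (ltnP i (size w)) => hi; last by rewrite nth_default.
have S0 : 0 < input_size w.
  by apply: leq_trans (size_le_input_size w); apply: leq_trans hi.
apply: ltnW; rewrite -bitlen_le // /input_size (big_nth 0) big_mkord (bigD1 (Ordinal hi)) //=.
exact: leq_addr.
Qed.

(** Loop bounds are polynomial in the value of the first input word, not in its bit length; that
    value is at most the number of words, hence at most the input size [S]. The memory starts below
    [2 ^ S] and grows by a polynomial amount, so its bit length stays polynomial. *)
Lemma poly_time_run (T : Type) (enc : T -> seq nat) (dom : T -> Prop)
    (correct : T -> seq nat -> Prop) (p : prog) :
  wf p ->
  (forall x, dom x -> nth 0 (enc x) 0 <= size (enc x) /\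
     correct x (output (run p (init_store (enc x))))) ->
  poly_time_solves enc dom correct (compile p).
Proof.
move=> wp hc.
have mono c n m : n <= m -> (n + c) ^ c <= (m + c) ^ c.
  by move=> h; case: (posnP c) => [->//|c0]; rewrite leq_exp2r // leq_add2r.
have [cw hw] := poly_bounded_work p; have [cp hp] := poly_bounded_puts p.
pose F S := (S + cw) ^ cw * (S + 1 + (2 * (S + cp) ^ cp + 1)).
have [c [d hcd]] : exists c d, forall S, F S <= c * S ^ d + c.
  apply: poly_boundedP; apply: poly_bounded_mul; first by exists cw.
  apply: poly_bounded_add.
    by apply: poly_bounded_add; [apply: poly_bounded_id | apply: poly_bounded_const].
  apply: poly_bounded_add; last exact: poly_bounded_const.
  by apply: poly_bounded_mul; [apply: poly_bounded_const | exists cp].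
exists c, d => x /hc[hn hx]; set S := input_size (enc x).
pose n := nth 0 (enc x) 0.
have nS : n <= S by apply: leq_trans hn (size_le_input_size _).
have [||t e1 l1] := @exec_compile p n (2 ^ S) (S + 1 + (2 * puts p n + 1)) _ wp _
  (@init_cells (enc x)) _ => //.
  apply: leq_trans (bitlen_add _ _) _; apply: leq_add.
    by rewrite bitlen_le ?addn1 // ltn_exp2l.
  by rewrite addn1 bitlen_leS.
exists t, (run p (init_store (enc x))); split=> //.
apply: leq_trans (hcd S); apply: leq_trans l1 _; apply: leq_mul.
  by apply: leq_trans (hw n) (mono _ _ _ nS).
by have := leq_trans (hp n) (mono cp _ _ nS); lia.
Qed.

Lemma run_put (a : nat) (ei ev : expr) (s : store) :
  run (PPut a ei ev) s = update s a (eval s ei) (eval s ev).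
Proof. by []. Qed.

Lemma run_when (e : expr) (p : prog) (s : store) :
  run (PWhen e p) s = if eval s e != 0 then run p s else s.
Proof. by []. Qed.

Lemma run_seq (p q : prog) (s : store) : run (PSeq p q) s = run q (run p s).
Proof. by []. Qed.

Arguments run : simpl never.

(** The step is told that cells outside the writes of the loop still hold their entry values, so an
    invariant need mention only what changes. *)
Lemma run_for (i : nat) (e : expr) (p : prog) (s : store)
    (P : nat -> store -> Prop) :
  ~~ writes p i -> P 0 (update s i 0 0) ->
  (forall k s', k < eval s e -> s' i 0 = k ->
     (forall a j, ~~ writes p a -> a != i -> s' a j = s a j) ->
     P k s' -> P k.+1 (tick i (run p s'))) ->
  P (eval s e) (run (PFor i e p) s).
Proof.
move=> wi P0 PS; rewrite /run -/run.
have h k : k <= eval s e ->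
    let s' := iter k (fun s' => tick i (run p s')) (update s i 0 0) in
    [/\ s' i 0 = k, forall a j, ~~ writes p a -> a != i -> s' a j = s a j & P k s'].
  elim: k => [_|k IH hk] /=.
    by split; rewrite ?updateE ?eqxx // => a j _ /negbTE ai; rewrite updateE ai.
  have [ik fk Pk] := IH (ltnW hk); split.
  - by rewrite tick_eq run_frame // ik.
  - by move=> a j wa ai; rewrite tick_neq // run_frame // fk.
  - exact: PS.
by have [] := h _ (leqnn _).
Qed.

(** Common shape of the relaxation, the auction and the tree moves: a pass either certifies the
    abstract state and keeps it, or makes progress measured by [mu]. *)
Definition sweeps (A : Type) (rep : A -> store -> Prop) (mu : A -> nat)
    (p : prog) (stable : A -> Prop) : Prop :=
  forall a s, rep a s ->
    stable a /\ rep a (run p s) \/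
    ~ stable a /\ exists2 a', rep a' (run p s) & mu a < mu a'.

(** As long as no turn has changed [a], all conditions checked so far concern that same [a]. Once a
    turn has changed it, one condition is known to fail for [a], and later turns can only increase
    [mu]. *)
Lemma sweeps_for (A : Type) (rep : A -> store -> Prop) (mu : A -> nat)
    (i : nat) (e : expr) (p : prog) (m : nat) (stable : nat -> A -> Prop) :
  ~~ writes p i ->
  (forall a s k, rep a s -> rep a (update s i 0 k)) ->
  (forall a s, rep a s -> eval s e = m) ->
  (forall k, k < m -> sweeps (fun a s => rep a s /\ s i 0 = k) mu p (stable k)) ->
  sweeps rep mu (PFor i e p) (fun a => forall k, k < m -> stable k a).
Proof.
move=> wi ri re hb a s ras; rewrite -(re _ _ ras) in hb *.
apply: (run_for (P := fun k s' =>
  (forall j, j < k -> stable j a) /\ rep a s' \/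
  ~ (forall j, j < k -> stable j a) /\ exists2 a', rep a' s' & mu a < mu a')) => //.
  by left; split=> //; apply: ri.
move=> k s' hk ik _ [[st ra]|[nst [a' ra' lt]]].
  have [[st' [ra' _]]|[nst' [a' [ra' _] lt]]] := hb k hk a s' (conj ra ik).
    left; split; last exact: ri.
    by move=> j; rewrite ltnS leq_eqVlt => /orP[/eqP->|/st].
  right; split; first by move=> h; apply: nst'; apply: h.
  by exists a' => //; apply: ri.
right; split; first by move=> h; apply: nst => j hj; apply: h; apply: ltnW.
have [[_ [r' _]]|[_ [a2 [r' _] lt2]]] := hb k hk a' s' (conj ra' ik).
  by exists a' => //; apply: ri.
by exists a2; [apply: ri | apply: ltn_trans lt2].
Qed.

(** After [k] passes either the state is stable, and then it stays so, or [mu] is at least [k]; more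
    than [B] passes leave only the first case. *)
Lemma sweeps_converge (A : Type) (rep : A -> store -> Prop) (mu : A -> nat)
    (i : nat) (e : expr) (p : prog) (B : nat) (stable : A -> Prop) (a : A) (s : store) :
  ~~ writes p i ->
  (forall a s k, rep a s -> rep a (update s i 0 k)) ->
  (forall a s, rep a s -> mu a <= B) ->
  sweeps rep mu p stable ->
  rep a s -> B < eval s e ->
  exists2 a', rep a' (run (PFor i e p) s) & stable a'.
Proof.
move=> wi ri hB hp ras hBe.
have [a' ra' [h|h]] : exists2 a', rep a' (run (PFor i e p) s) &
    (eval s e <= mu a' \/ stable a').
- apply: (run_for (P := fun k s' => exists2 a', rep a' s' & k <= mu a' \/ stable a')) => //.
    by exists a; [apply: ri | left].
  move=> k s' _ _ _ [a1 ra1 h1].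
  have [[st ra2]|[nst [a2 ra2 lt]]] := hp _ _ ra1.
    by exists a1; [apply: ri | right].
  exists a2; first exact: ri.
  by left; case: h1 => // h1; apply: leq_ltn_trans lt.
- by have := hB _ _ ra'; lia.
- by exists a'.
Qed.

(** The two truncated differences add up to the absolute difference. On guards, products act as
    conjunctions and sums as disjunctions. *)
Definition e_eq (e1 e2 : expr) : expr :=
  ESub (EConst 1) (EAdd (ESub e1 e2) (ESub e2 e1)).
Definition e_lt (e1 e2 : expr) : expr := ESub e2 e1.

Arguments e_eq : simpl never.
Arguments e_lt : simpl never.

Lemma eval_eq (s : store) (e1 e2 : expr) :
  (eval s (e_eq e1 e2) != 0) = (eval s e1 == eval s e2).
Proof. by rewrite /e_eq /=; case: eqP => h; lia. Qed.

Lemma eval_lt (s : store) (e1 e2 : expr) :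
  (eval s (e_lt e1 e2) != 0) = (eval s e1 < eval s e2).
Proof. by rewrite /e_lt /= subn_eq0 -ltnNge. Qed.

Lemma eval_and (s : store) (e1 e2 : expr) :
  (eval s (EMul e1 e2) != 0) = (eval s e1 != 0) && (eval s e2 != 0).
Proof. by rewrite /= muln_eq0 negb_or. Qed.

Lemma eval_or (s : store) (e1 e2 : expr) :
  (eval s (EAdd e1 e2) != 0) = (eval s e1 != 0) || (eval s e2 != 0).
Proof. by rewrite /= addn_eq0 negb_and. Qed.

(** * Distances *)

(* Arrays: 2 distances and 3 next hops, both in row-major order; 4 the target of
   the token on each vertex, where [n] stands for no target during the auction;
   5 prices; 6 best offer; 7 and 8 the ends of the next swap; 9 swap buffer;
   10 to 13 loop counters; 15 the vertex of the carried token; 16 the vertex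
   whose token has target 15; 17 a shortest path from 16 to 15. *)

Notation nv := (EGet 0 (EConst 1)).
Notation index2 u v := (EAdd (EMul u nv) v).
Notation adjacent u v := (EGet 0 (EAdd (EConst 2) (index2 u v))).
Notation dist u v := (EGet 2 (index2 u v)).
Notation hop u v := (EGet 3 (index2 u v)).

Definition relax : prog :=
  PWhen (EMul (adjacent (cell 10) (cell 12))
           (e_lt (EAdd (dist (cell 12) (cell 11)) (EConst 1)) (dist (cell 10) (cell 11))))
    (PSeq (PPut 2 (index2 (cell 10) (cell 11))
             (EAdd (dist (cell 12) (cell 11)) (EConst 1)))
       (PPut 3 (index2 (cell 10) (cell 11)) (cell 12))).

Definition relax_all : prog :=
  PFor 10 nv (PFor 11 nv (PFor 12 nv relax)).

Definition dist_fill : prog :=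
  PFor 10 nv (PFor 11 nv (PPut 2 (index2 (cell 10) (cell 11)) nv)).

Definition dist_diag : prog :=
  PFor 10 nv (PPut 2 (index2 (cell 10) (cell 10)) (EConst 0)).

Definition dist_init : prog := PSeq dist_fill dist_diag.

(** Each effective pass lowers some of the [n * n] entries, all at most [n], so one pass more than
    the cube of [n] suffices. *)
Definition dist_prog : prog :=
  PSeq dist_init
    (PFor 13 (EAdd (EMul nv (EMul nv nv)) (EConst 1)) relax_all).

Lemma index2_eq (n : nat) (u v u' v' : 'I_n) :
  (u * n + v == u' * n + v') = (u == u') && (v == v').
Proof.
apply/eqP/andP => [h|[/eqP-> /eqP->] //].
have n0 : 0 < n by apply: leq_ltn_trans (ltn_ord u).
have h1 := f_equal (divn^~ n) h; have h2 := f_equal (modn^~ n) h.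
move: h1 h2; rewrite !divnMDl // !modnMDl !divn_small // !modn_small // !addn0.
by split; apply/eqP/val_inj.
Qed.

Section Algorithm.

Variable I : cts_instance.
Notation G := (graph I).
Notation n := (nvert (graph I)).
Notation V := 'I_(nvert (graph I)).
Implicit Types (s : store) (u v w x y : V).

Definition input_rep s : Prop :=
  [/\ s 0 1 = n,
      forall u v, s 0 (2 + (u * n + v)) = adj u v,
      forall x, s 0 (2 + n * n + x) = vcol x &
      forall u, s 0 (2 + n * n + n + u) = tcol u].

Lemma input_frame s s' :
  (forall j, s' 0 j = s 0 j) -> input_rep s -> input_rep s'.
Proof. by move=> h [h1 h2 h3 h4]; split=> *; rewrite h. Qed.

Lemma input_update s a i k : a != 0 -> input_rep s -> input_rep (update s a i k).
Proof.
by move=> a0; apply: input_frame => j; rewrite updateE eq_sym (negbTE a0).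
Qed.

Definition arr1 s (a : nat) (f : V -> nat) : Prop := forall x, s a x = f x.
Definition arr2 s (a : nat) (f : V -> V -> nat) : Prop :=
  forall u v, s a (u * n + v) = f u v.

Lemma arr1_frame s s' a f :
  (forall j, s' a j = s a j) -> arr1 s a f -> arr1 s' a f.
Proof. by move=> h hf x; rewrite h. Qed.

Lemma arr2_frame s s' a f :
  (forall j, s' a j = s a j) -> arr2 s a f -> arr2 s' a f.
Proof. by move=> h hf x y; rewrite h. Qed.

Lemma arr2_update_neq s a f b i k : a != b -> arr2 s a f -> arr2 (update s b i k) a f.
Proof. by move=> /negbTE h; apply: arr2_frame => j; rewrite updateE h. Qed.

Lemma arr2_update s a f u v k :
  arr2 s a f ->
  arr2 (update s a (u * n + v) k) a (fun x y => if (x == u) && (y == v) then k else f x y).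
Proof. by move=> h x y; rewrite updateE eqxx /= index2_eq h. Qed.

(** The value [n] plays the role of infinity. The last field has only a strict inequality because
    the entry of the neighbour may be improved after the hop was recorded. *)
Record dist_inv (D : V -> V -> nat) (N : V -> V -> V) : Prop := DistInv {
  dist_inv_le : forall u v, D u v <= n;
  dist_inv_refl : forall u, D u u = 0;
  dist_inv_eq : forall u v, D u v = 0 -> u = v;
  dist_inv_hop : forall u v, u != v ->
    D u v = n \/ adj u (N u v) /\ D (N u v) v < D u v
}.

Definition dist_rep (DN : (V -> V -> nat) * (V -> V -> V)) s : Prop :=
  [/\ input_rep s, arr2 s 2 DN.1, arr2 s 3 (fun u v => DN.2 u v) &
      dist_inv DN.1 DN.2].

Definition dist_mu (DN : (V -> V -> nat) * (V -> V -> V)) : nat :=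
  \sum_u \sum_v (n - DN.1 u v).

Lemma dist_rep_update DN s a i k :
  [&& a != 0, 2 != a & 3 != a] -> dist_rep DN s -> dist_rep DN (update s a i k).
Proof.
move=> /and3P[a0 a2 a3] [h1 h2 h3 h4]; split=> //; first exact: input_update.
  exact: arr2_update_neq.
exact: arr2_update_neq.
Qed.

Lemma relax_sweeps u v w :
  sweeps (fun DN s => ((dist_rep DN s /\ s 10 0 = u) /\ s 11 0 = v) /\ s 12 0 = w)
    dist_mu relax (fun DN => ~~ (adj u w && ((DN.1 w v).+1 < DN.1 u v))).
Proof.
move=> [D N] s [[[hr su] sv] sw]; have [[sn sadj sv' st] hD hN hi] := hr.
have E : run relax s = if adj u w && ((D w v).+1 < D u v) then
    update (update s 2 (u * n + v) (D w v).+1) 3 (u * n + v) w else s.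
  rewrite /relax run_when run_seq !run_put eval_and eval_lt /=.
  rewrite su sv sw sn sadj !hD /= addn1 eqb0 negbK.
  by rewrite !updateE /= su sv sw sn.
rewrite E; case: ifP => hc /=; last by left.
right; split; first by move=> h.
have [adjuw lt] := andP hc.
exists (fun x y => if (x == u) && (y == v) then (D w v).+1 else D x y,
        fun x y => if (x == u) && (y == v) then w else N x y).
  rewrite !updateE /=; split=> //; split=> //; split=> //; split=> /=.
  - by do 2!(apply: input_update => //).
  - by apply: arr2_update_neq => //; apply: arr2_update.
  - by move=> x y; rewrite updateE /= index2_eq; case: ifP => // _; rewrite updateE; apply: hN.
  - case: hi => /= h1 h2 h3 h4.
    have lt0 : (D w v).+1 < D u v by [].
    have uv : u != v by apply/eqP => e; move: lt0; rewrite e h2.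
    split=> [x y|x|x y|x y].
    + by case: ifP => // _; have := h1 u v; rewrite /=; lia.
    + by case: ifP => // /andP[/eqP e1 /eqP e2]; move: uv; rewrite -e1 -e2 eqxx.
    + by case: ifP => // _; apply: h3.
    + move=> xy; case: ifP => [/andP[/eqP-> /eqP->]|hxy].
        right; split=> //; case: ifP => // /andP[/eqP e _].
        by move: lt0; rewrite e; lia.
      case: (h4 _ _ xy) => [|[a1 a2]]; [by left | right; split=> //].
      by case: ifP => // /andP[/eqP e1 /eqP e2]; move: a2; rewrite /= e1 e2; lia.
rewrite /dist_mu /= (bigD1 u) //= [X in _ < X](bigD1 u) //=.
have le x y : (if (x == u) && (y == v) then (D w v).+1 else D x y) <= D x y.
  by case: ifP => // /andP[/eqP-> /eqP->]; apply: ltnW.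
rewrite -addSn; apply: leq_add; last first.
  by apply: leq_sum => x _; apply: leq_sum => y _; rewrite leq_sub2l.
rewrite (bigD1 v) //= [X in _ < X](bigD1 v) //= -addSn; apply: leq_add; last first.
  by apply: leq_sum => y _; rewrite leq_sub2l.
by rewrite !eqxx; have := dist_inv_le hi u v; rewrite /=; lia.
Qed.

Lemma relax_all_sweeps :
  sweeps dist_rep dist_mu relax_all
    (fun DN => forall u v w, adj u w -> DN.1 u v <= (DN.1 w v).+1).
Proof.
have h : sweeps dist_rep dist_mu relax_all (fun DN =>
    forall k, k < n -> forall l, l < n -> forall m, m < n ->
    forall u v w, k = u -> l = v -> m = w ->
    ~~ (adj u w && ((DN.1 w v).+1 < DN.1 u v))).
  apply: sweeps_for => [//|||k hk].
  - by move=> a s k h; apply: dist_rep_update.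
  - by move=> a s [[]].
  apply: sweeps_for => [//|||l hl].
  - by move=> a s m [h1 h2]; split=> //; apply: dist_rep_update.
  - by move=> a s [[[]]].
  apply: sweeps_for => [//|||m hm].
  - by move=> a s m [[h1 h2] h3]; split=> //; split=> //; apply: dist_rep_update.
  - by move=> a s [[[[]]]].
  move=> a s hr.
  have [[h1 h2]|[h1 h2]] := @relax_sweeps (Ordinal hk) (Ordinal hl) (Ordinal hm) a s hr.
    left; split=> // u v w eu ev ew.
    have -> : u = Ordinal hk by apply: val_inj.
    have -> : v = Ordinal hl by apply: val_inj.
    by have -> : w = Ordinal hm by apply: val_inj.
  by right; split=> // h3; apply: h1; apply: h3.
move=> a s hr; have [[h1 h2]|[h1 h2]] := h a s hr; [left | right]; split=> //.
  move=> u v w auw; rewrite leqNgt; apply/negP => lt.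
  have := h1 u (ltn_ord u) v (ltn_ord v) w (ltn_ord w) u v w erefl erefl erefl.
  by rewrite auw lt.
move=> h3; apply: h1 => k _ l _ m _ u v w _ _ _; apply/negP => /andP[auw].
by rewrite ltnNge h3.
Qed.

Lemma dist_mu_le DN : dist_mu DN <= n * (n * n).
Proof.
apply: (@leq_trans (\sum_(u < n) n * n)); last by rewrite sum_nat_const card_ord.
apply: leq_sum => u _.
apply: (@leq_trans (\sum_(v < n) n)); last by rewrite sum_nat_const card_ord.
by apply: leq_sum => v _; apply: leq_subr.
Qed.

(** These properties force [D] to be the graph distance: the Lipschitz condition bounds it by the
    length of any path, and following the hops gives a path of length exactly [D u v]. *)
Record hop_table (D : V -> V -> nat) (N : V -> V -> V) : Prop := HopTable {
  hop_le : forall u v, D u v <= n;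
  hop_refl : forall u, D u u = 0;
  hop_eq : forall u v, D u v = 0 -> u = v;
  hop_lip : forall u v w, adj u w -> D u v <= (D w v).+1;
  hop_adj : forall u v, u != v -> adj u (N u v);
  hop_dec : forall u v, u != v -> D u v = (D (N u v) v).+1
}.

Lemma dist_path_le D u v p :
  (forall u, D u u = 0) ->
  (forall u v w, adj u w -> D u v <= (D w v).+1) ->
  path (@adj G) u p -> last u p = v -> D u v <= size p.
Proof.
move=> h0 h1; elim: p u => [|w p IH] u /=; first by move=> _ ->; rewrite h0.
by move=> /andP[/h1 h /IH h2] /h2; have := h v; lia.
Qed.

(** Connectedness gives a simple path, with fewer than [n] edges, so no entry is still infinite.
    Stability then turns the strict decrease along a hop into a decrease by exactly 1. *)
Lemma hop_table_stable D N :
  dist_inv D N -> (forall u v w, adj u w -> D u v <= (D w v).+1) -> hop_table D N.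
Proof.
case=> h1 h2 h3 h4 h5.
have lt u v : D u v < n.
  have /connectP[p hp ->] := graph_conn u v.
  case: (shortenP hp) => p' hp' up' _ {p hp}.
  have := dist_path_le h2 h5 hp' erefl; have := card_uniqP up' => /= c.
  by have := max_card (mem (u :: p')); rewrite c card_ord => a b; apply: leq_ltn_trans b a.
have h u v : u != v -> adj u (N u v) /\ D u v = (D (N u v) v).+1.
  move=> /h4[e|[a l]]; first by have := lt u v; rewrite e ltnn.
  by split=> //; apply/eqP; rewrite eqn_leq l h5.
by split=> // u v /h[].
Qed.

Lemma dist_init_spec s :
  input_rep s -> (forall j, s 3 j = 0) -> exists DN, dist_rep DN (run dist_init s).
Proof.
move=> hi z3; rewrite /dist_init run_seq.
have h1 : forall u v, run dist_fill s 2 (u * n + v) = n.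
  move=> u; rewrite /dist_fill; have sn : eval s nv = n by case: hi.
  have := @run_for 10 nv (PFor 11 nv (PPut 2 (index2 (cell 10) (cell 11)) nv)) s
    (fun k s' => forall u v, u < k -> s' 2 (u * n + v) = n).
  rewrite sn => h v; apply: (h isT _ _ u v (ltn_ord u)) => // {h}k s1 hk ik fr IH {}u {}v hu.
  rewrite tick_neq //.
  have := @run_for 11 nv (PPut 2 (index2 (cell 10) (cell 11)) nv) s1
    (fun l s' => s' 10 0 = k /\
      forall u v : V, u < k \/ u = k :> nat /\ v < l -> s' 2 (u * n + v) = n).
  have sn1 : s1 0 1 = n by rewrite fr.
  rewrite [eval s1 nv]/= sn1; case.
  - by [].
  - rewrite !updateE /=; split=> // x y [|[]//]; rewrite updateE /=; exact: IH.
  - move=> l s2 hl il fr2 [s2k IH2]; split; first by rewrite tick_neq // run_put /= !updateE.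
    move=> x y hxy; rewrite tick_neq // run_put /= updateE /= s2k il fr2 // sn1.
    have -> : k = Ordinal hk by [].
    have -> : l = Ordinal hl by [].
    rewrite index2_eq; case: ifP => // hne; apply: IH2.
    case: hxy => [|[e]]; [by left | rewrite ltnS leq_eqVlt => /orP[/eqP e'|]].
      by case/negP: hne; rewrite -!val_eqE /= e e' !eqxx.
    by right.
  by move=> _ /(_ u v); apply; move: hu; rewrite ltnS leq_eqVlt => /orP[/eqP|]; auto.
have h2 : forall u v, run dist_diag (run dist_fill s) 2 (u * n + v) = if u == v then 0 else n.
  have sn : run dist_fill s 0 1 = n by rewrite run_frame //; case: hi.
  have en : eval (run dist_fill s) nv = n := sn.
  have := @run_for 10 nv (PPut 2 (index2 (cell 10) (cell 10)) (EConst 0)) (run dist_fill s)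
    (fun k s' => forall u v, s' 2 (u * n + v) = if (u == v) && (u < k) then 0 else n).
  rewrite en => h u v; rewrite h ?ltn_ord ?andbT // {h u v}.
    by move=> u v; rewrite updateE /= h1 andbF.
  move=> k s1 hk ik fr IH u v; rewrite tick_neq // run_put /= updateE /= ik fr // sn IH.
  have -> : k = Ordinal hk by [].
  have -> : (u < k.+1) = (u == k :> nat) || (u < k) by rewrite ltnS leq_eqVlt.
  rewrite index2_eq -!val_eqE /=.
  case: (eqVneq (u : nat) v) => [->|uv] /=; first by rewrite andbb; case: eqP.
  by case: (eqVneq (u : nat) k) => [e|//]; rewrite -e eq_sym (negbTE uv).
pose D u v := if u == v then 0 else n.
(* Array 3 is still zero, so every next hop reads as vertex 0, which exists because [u] does. *)
pose N u (v : V) : V := Ordinal (leq_ltn_trans (leq0n u) (ltn_ord u)).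
exists (D, N); split=> //=.
- by apply: input_frame hi => j; rewrite !run_frame.
- by move=> u v; rewrite !run_frame // z3.
split=> [u v|u|u v|u v].
- by rewrite /D; case: ifP.
- by rewrite /D eqxx.
- by rewrite /D; case: eqP => // _ e; have := ltn_ord u; rewrite [X in _ < X]e.
- by rewrite /D => /negbTE->; left.
Qed.

Lemma dist_prog_spec s :
  input_rep s -> (forall j, s 3 j = 0) ->
  exists (D : V -> V -> nat) (N : V -> V -> V),
    [/\ input_rep (run dist_prog s), arr2 (run dist_prog s) 2 D,
    arr2 (run dist_prog s) 3 (fun u v => N u v) & hop_table D N].
Proof.
move=> hi z3; have [DN hr] := dist_init_spec hi z3.
have sn : run dist_init s 0 1 = n by rewrite run_frame //; case: hi.
have := @sweeps_converge _ dist_rep dist_mu 13 (EAdd (EMul nv (EMul nv nv)) (EConst 1))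
  relax_all (n * (n * n)) _ DN (run dist_init s) isT _ _ relax_all_sweeps hr.
case.
- by move=> a s' k; apply: dist_rep_update.
- by move=> *; apply: dist_mu_le.
- by rewrite /= sn addn1.
move=> [D N] [h1 h2 h3 h4] st; exists D, N.
by split=> //; apply: hop_table_stable.
Qed.

End Algorithm.

(** * The auction *)

Notation tok_color u :=
  (EGet 0 (EAdd (EAdd (EAdd (EConst 2) (EMul nv nv)) nv) u)).
Notation vert_color x := (EGet 0 (EAdd (EAdd (EConst 2) (EMul nv nv)) x)).
Notation price x := (EGet 5 x).
Notation bid_cost u x := (EAdd (EMul (EAdd nv (EConst 1)) (dist u x)) (price x)).

Definition scan_step : prog :=
  PWhen (EMul (e_eq (tok_color (cell 10)) (vert_color (cell 11)))
           (EAdd (e_eq (cell 6) nv)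
              (e_lt (bid_cost (cell 10) (cell 11)) (bid_cost (cell 10) (cell 6)))))
    (PPut 6 (EConst 0) (cell 11)).

Definition scan : prog := PFor 11 nv scan_step.

Definition evict_step : prog :=
  PWhen (e_eq (EGet 4 (cell 12)) (cell 6)) (PPut 4 (cell 12) nv).

Definition evict : prog := PFor 12 nv evict_step.

Definition bid : prog :=
  PWhen (e_eq (EGet 4 (cell 10)) nv)
    (PSeq (PPut 6 (EConst 0) nv)
    (PSeq scan
    (PSeq (PPut 5 (cell 6) (EAdd (price (cell 6)) (EConst 1)))
    (PSeq evict (PPut 4 (cell 10) (cell 6)))))).

Definition auction_fill : prog := PFor 10 nv (PPut 4 (cell 10) nv).

(** The number of passes exceeds [n] times the price bound of [auction_price], hence the largest
    possible sum of the prices. *)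
Definition auction : prog :=
  PSeq auction_fill
    (PFor 13 (EAdd (EMul nv (EAdd (EMul (EAdd nv (EConst 1)) nv) (EConst 1))) (EConst 1))
       (PFor 10 nv bid)).

Section Auction.

Variable I : cts_instance.
Notation G := (graph I).
Notation n := (nvert (graph I)).
Notation V := 'I_(nvert (graph I)).
Variables (D : V -> V -> nat) (N : V -> V -> V).
Hypothesis hopDN : hop_table D N.
Implicit Types (s : store) (u v w x y : V) (g : V -> option V) (q : V -> nat).

Definition cost q u x : nat := (n + 1) * D u x + q x.

(** [auction_slack] is approximate complementary slackness with tolerance 1, for distances scaled by
    [n + 1]. [auction_sold] expresses that a target once taken changes hands but is never
    released. *)
Record auction_inv g q : Prop := AuctionInv {
  auction_color : forall u x, g u = Some x -> tcol u = vcol x;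
  auction_inj : forall u v x, g u = Some x -> g v = Some x -> u = v;
  auction_sold : forall x, 0 < q x -> exists u, g u = Some x;
  auction_slack : forall u x y, g u = Some x -> tcol u = vcol y ->
    cost q u x <= (cost q u y).+1;
  auction_price : forall x, q x <= (n + 1) * n + 1
}.

(** Pigeonhole: if all targets of the color of [u] had positive price, they would be owned by
    distinct tokens of that color other than [u], against the color balance. *)
Lemma unsold_target g q u :
  auction_inv g q -> g u = None -> exists2 y, tcol u = vcol y & q y = 0.
Proof.
move=> hi gu.
have [/existsP[y /andP[/eqP h1 /eqP h2]]|/existsPn h] :=
  boolP [exists y, (tcol u == vcol y) && (q y == 0)]; first by exists y.
have: #|[set v : V | vcol v == tcol u]| <= #|[set v : V | tcol v == tcol u] :\ u|.
  apply: leq_trans _ (leq_imset_card (fun v => odflt u (g v)) _).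
  apply: subset_leq_card; apply/subsetP => y; rewrite inE => /eqP hy.
  have := h y; rewrite hy eqxx /= -lt0n => /(auction_sold hi)[v gv].
  apply/imsetP; exists v; last by rewrite gv.
  rewrite !inE (auction_color hi gv) hy eqxx andbT.
  by apply/eqP => e; move: gv; rewrite e gu.
rewrite -col_balanced (cardsD1 u [set v : V | tcol v == tcol u]) inE eqxx.
by rewrite add1n ltnn.
Qed.

Definition bid_assign g u (b : V) : V -> option V :=
  fun z => if z == u then Some b else if g z == Some b then None else g z.
Definition bid_price q (b : V) : V -> nat := fun x => if x == b then (q b).+1 else q x.

(** Raising a price only makes the alternatives of the other tokens dearer, and costs [u] exactly
    the permitted slack of 1. The price stays bounded because [u] could have taken an unsold target
    at cost at most [(n + 1) * n]. *)
Lemma bid_inv g q u (b : V) :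
  auction_inv g q -> g u = None -> tcol u = vcol b ->
  (forall y, tcol u = vcol y -> cost q u b <= cost q u y) ->
  auction_inv (bid_assign g u b) (bid_price q b).
Proof.
move=> hi gu ub hmin.
have le x : q x <= bid_price q b x by rewrite /bid_price; case: eqP => [->|].
have lec z x : cost q z x <= cost (bid_price q b) z x by rewrite leq_add2l.
split=> [z x|z z' x|x|z x y|x]; rewrite ?/bid_assign.
- case: eqP => [-> [<-] //|_]; case: ifP => // _; exact: (auction_color hi).
- case: (z =P u) => [->|zu]; case: (z' =P u) => [->|zu'] //.
  + by move=> [<-]; case: ifP => // /eqP h /h.
  + by move=> h [e]; move: h; rewrite -e; case: ifP => // /eqP h /h.
  + do 2!(case: ifP => // _); exact: (auction_inj hi).
- rewrite /bid_price; case: eqP => [->|xb] h; first by exists u; rewrite eqxx.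
  have [v gv] := auction_sold hi h; exists v.
  case: eqP => [e|_]; first by move: gv; rewrite e gu.
  by rewrite gv; case: eqP => // -[].
- case: eqP => [-> [<-] uy|zu].
    have := leq_trans (hmin y uy) (lec u y).
    by rewrite /cost {2}/bid_price eqxx; lia.
  case: ifP => // gb gx zy.
  apply: leq_trans (_ : _ <= (cost q z y).+1) _; last by rewrite ltnS lec.
  have xb : x != b by apply/eqP => e; move: gb; rewrite gx e eqxx.
  by rewrite {1}/cost /bid_price (negbTE xb); apply: (auction_slack hi).
- rewrite /bid_price; case: eqP => _; last exact: (auction_price hi).
  have [y uy qy] := unsold_target hi gu.
  have := hmin y uy; rewrite /cost qy.
  have : (n + 1) * D u y <= (n + 1) * n by rewrite leq_mul2l (hop_le hopDN) orbT.
  lia.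
Qed.

Definition code (o : option V) : nat := if o is Some x then val x else n.

Lemma code_n o : (code o == n) = (o == None).
Proof. by case: o => [x|]; rewrite /= ?eqxx // ltn_eqF. Qed.

Lemma code_val o x : (code o == x) = (o == Some x).
Proof. by case: o => [y|] //=; rewrite gtn_eqF. Qed.

Definition tables s : Prop :=
  [/\ input_rep I s, arr2 s 2 D & arr2 s 3 (fun u v => N u v)].

Lemma tables_frame s s' :
  (forall a j, a \in [:: 0; 2; 3] -> s' a j = s a j) -> tables s -> tables s'.
Proof.
move=> h [h1 h2 h3]; split.
- by apply: input_frame h1 => j; apply: h.
- by apply: arr2_frame h2 => j; apply: h.
- by apply: arr2_frame h3 => j; apply: h.
Qed.

Lemma tables_run p s :
  [&& ~~ writes p 0, ~~ writes p 2 & ~~ writes p 3] -> tables s -> tables (run p s).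
Proof.
move=> /and3P[h0 h2 h3]; apply: tables_frame => a j.
by rewrite !inE => /or3P[] /eqP->; rewrite run_frame.
Qed.

Lemma tables_update s a i k :
  [&& a != 0, a != 2 & a != 3] -> tables s -> tables (update s a i k).
Proof.
move=> /and3P[h0 h2 h3]; apply: tables_frame => b j.
by rewrite !inE updateE => /or3P[] /eqP->; rewrite eq_sym ?(negbTE h0, negbTE h2, negbTE h3).
Qed.

Lemma tables_n s : tables s -> s 0 1 = n.
Proof. by case; case. Qed.

Definition auction_rep (gq : (V -> option V) * (V -> nat)) s : Prop :=
  [/\ tables s, arr1 s 4 (code \o gq.1), arr1 s 5 gq.2 & auction_inv gq.1 gq.2].

Lemma scan_spec s q u :
  tables s -> arr1 s 5 q -> s 10 0 = u -> s 6 0 = n ->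
  (exists y, tcol u = vcol y) ->
  exists b : V, [/\ run scan s 6 0 = b, tcol u = vcol b &
    forall y, tcol u = vcol y -> cost q u b <= cost q u y].
Proof.
move=> ht hq su s6 [y0 hy0]; have sn := tables_n ht.
have en : eval s nv = n := sn.
have := @run_for 11 nv scan_step s (fun k s' =>
  (s' 6 0 = n /\ forall y, y < k -> tcol u <> vcol y) \/
  exists b : V, [/\ s' 6 0 = b, tcol u = vcol b &
    forall y, y < k -> tcol u = vcol y -> cost q u b <= cost q u y])
  isT.
rewrite -/scan en => h; case: h.
- by left; rewrite updateE.
- move=> k s' hk ik fr IH.
  have [[hi1 hi2 hi3 hi4] hD hN] := ht.
  rewrite /scan_step run_when eval_and eval_eq eval_or eval_eq eval_lt run_put.
  rewrite tick_neq //=.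
  have f0 j : s' 0 j = s 0 j by rewrite fr.
  have f2 j : s' 2 j = s 2 j by rewrite fr.
  have f5 j : s' 5 j = s 5 j by rewrite fr.
  have -> : s' 10 0 = u by rewrite fr.
  rewrite !f0 !f2 !f5 sn ik hi4.
  have ek : k = Ordinal hk by [].
  rewrite ek hi3 hD hq -ek.
  have ltS y : y < k.+1 -> y < k \/ y = Ordinal hk.
    rewrite ltnS leq_eqVlt => /orP[/eqP e|]; last by left.
    by right; apply: val_inj.
  (* While cell 6 holds [n], the cost of the current best offer is read out of range; the disjunct
     testing for [n] makes the guard independent of it. *)
  case: IH => [[e6 hno]|[b [e6 hb hmin]]]; rewrite e6.
    rewrite eqxx /= andbT; case: eqP => hc.
      right; exists (Ordinal hk); split=> //.
      by move=> y /ltS[/hno//|->].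
    left; split=> // y /ltS[/hno//|->//].
  rewrite (ltn_eqF (ltn_ord b)) /= hD hq.
  right; case: ifP => [/andP[/eqP hc lt]|hc].
    exists (Ordinal hk); split=> //.
    move=> y /ltS[/hmin hy /hy|->//]; apply: leq_trans; exact: ltnW.
  exists b; split=> // y /ltS[/hmin//|-> uy].
  by move: hc; rewrite uy eqxx /= ltnNge => /negbFE.
- by move=> [_ /(_ y0 (ltn_ord y0))].
- by move=> [b [h1 h2 h3]]; exists b; split=> // y; apply: h3.
Qed.

Lemma evict_spec s g (b : V) :
  s 0 1 = n -> arr1 s 4 (code \o g) -> s 6 0 = b ->
  arr1 (run evict s) 4 (code \o (fun z => if g z == Some b then None else g z)).
Proof.
move=> sn h4 s6; have en : eval s nv = n := sn.
have := @run_for 12 nv evict_step s (fun k s' => arr1 s' 4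
  (code \o (fun z : V => if (z < k) && (g z == Some b) then None else g z))) isT.
rewrite -/evict en => h z; rewrite h /= ?ltn_ord // {h z}.
move=> k s' hk ik fr IH z.
have -> : run evict_step s' = if s' 4 k == b then update s' 4 k n else s'.
  by rewrite /evict_step run_when eval_eq run_put /= ik !(fr 6, fr 0) // sn s6.
have ek : k = Ordinal hk by [].
have zk : (z < k.+1) = (z == Ordinal hk) || (z < k) by rewrite ltnS leq_eqVlt.
rewrite tick_neq // {1}ek IH /= ltnn /= code_val zk; case: ifP => gb.
  rewrite updateE eqxx /= {1}ek val_eqE IH /=.
  by case: (z =P Ordinal hk) => [->|//]; rewrite gb.
by rewrite IH /=; case: (z =P Ordinal hk) => [->|//]; rewrite gb !andbF.
Qed.

(** The sum of the prices measures progress: a bid raises exactly one price, by 1, even when it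
    evicts an owner and leaves the number of assigned tokens unchanged. *)
Lemma bid_sweeps u :
  sweeps (fun gq s => auction_rep gq s /\ s 10 0 = u) (fun gq => \sum_x gq.2 x)
    bid (fun gq => gq.1 u != None).
Proof.
move=> [g q] s [hr su]; have [ht h4 h5 hi] := hr; have sn := tables_n ht.
rewrite /bid run_when eval_eq /= su h4 sn code_n.
case: eqP => gu; last by left; split=> //; apply/eqP.
right; split=> //; rewrite !run_seq.
set s1 := run (PPut _ _ _) s.
have [y0 hy0 _] := unsold_target hi gu.
have hs1 : forall a j, a != 6 -> s1 a j = s a j.
  by move=> a j /negbTE h; rewrite /s1 run_put updateE h.
have ht1 : tables s1 by apply: tables_run.
have [||||b [sb ub hmin]] := @scan_spec s1 q u ht1.
- by move=> x; rewrite hs1.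
- by rewrite hs1.
- by rewrite /s1 run_put updateE.
- by exists y0.
set s2 := run scan s1 in sb *; have ht2 : tables s2 by apply: tables_run.
have hs2 : forall a j, a \notin [:: 6; 11] -> s2 a j = s a j.
  move=> a j; rewrite !inE negb_or => /andP[h6 h11].
  by rewrite /s2 run_frame ?hs1 //= !negb_or h11 h6.
set s3 := run (PPut _ _ _) s2; have ht3 : tables s3 by apply: tables_run.
have s3E : s3 = update s2 5 b (q b).+1.
  by rewrite /s3 run_put /= sb hs2 // h5 addn1.
have h43 : arr1 s3 4 (code \o g) by move=> x; rewrite s3E updateE /= hs2.
have h44 := evict_spec (tables_n ht3) h43 (_ : s3 6 0 = b).
set s4 := run evict s3 in h44 *; have ht4 : tables s4 by apply: tables_run.
exists (bid_assign g u b, bid_price q b).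
  have s410 : s4 10 0 = u by rewrite /s4 run_frame // s3E updateE /= hs2.
  have s46 : s4 6 0 = b by rewrite /s4 run_frame // s3E updateE.
  split; last by rewrite run_frame.
  split; [exact: tables_run | | | exact: bid_inv].
    move=> z; rewrite run_put /= s410 s46 updateE eqxx /= val_eqE.
    rewrite /bid_assign; case: eqP => // _.
    by rewrite h44 // s3E updateE.
  move=> z; rewrite run_frame // /s4 run_frame // s3E updateE eqxx /= val_eqE.
  by rewrite /bid_price; case: eqP => // _; rewrite hs2.
rewrite /= (bigD1 b) //= [X in _ < X](bigD1 b) //= {1}/bid_price eqxx addSn ltnS.
rewrite leq_add2l; apply: leq_sum => x /negbTE xb.
by rewrite /bid_price xb.
Qed.

Lemma auction_sweeps :
  sweeps auction_rep (fun gq => \sum_x gq.2 x) (PFor 10 nv bid)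
    (fun gq => forall u, gq.1 u != None).
Proof.
have h : sweeps auction_rep (fun gq => \sum_x gq.2 x) (PFor 10 nv bid) (fun gq =>
    forall k, k < n -> forall u, k = u -> gq.1 u != None).
  apply: sweeps_for => [//|||k hk].
  - move=> gq s k [h1 h2 h3 h4]; split=> //; exact: tables_update.
  - by move=> gq s [/tables_n].
  move=> gq s hr; have [[h1 h2]|[h1 h2]] := @bid_sweeps (Ordinal hk) gq s hr.
    by left; split=> // u eu; have -> : u = Ordinal hk by apply: val_inj.
  by right; split=> // h3; apply: h1; apply: h3.
move=> gq s hr; have [[h1 h2]|[h1 h2]] := h gq s hr; [left | right]; split=> //.
by move=> u; apply: (h1 u).
Qed.

Lemma auction_fill_spec s :
  tables s -> arr1 (run auction_fill s) 4 (fun _ : V => n).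
Proof.
move=> ht; have en : eval s nv = n := tables_n ht.
have := @run_for 10 nv (PPut 4 (cell 10) nv) s
  (fun k s' => forall x : V, x < k -> s' 4 x = n) isT.
rewrite -/auction_fill en => h x; apply: h (ltn_ord x) => // {}x.
move=> s' hk ik fr IH z; rewrite tick_neq // run_put /= updateE ik fr // (tables_n ht).
by rewrite ltnS leq_eqVlt; case: eqP => //= _; apply: IH.
Qed.

(** When the slack inequalities are summed, the prices cancel because [f] and [p] are both
    bijections. The remaining error [n] is smaller than the scaling factor [n + 1]. *)
Lemma auction_optimal g q (f p : {perm V}) :
  auction_inv g q -> (forall u, g u = Some (f u)) ->
  (forall u, tcol u = vcol (p u)) ->
  \sum_u D u (f u) <= \sum_u D u (p u).
Proof.
move=> hi gf hp.
have reidx (r : {perm V}) : \sum_u q (r u) = \sum_u q u.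
  by rewrite [RHS](reindex_inj (@perm_inj _ r)).
have: \sum_u cost q u (f u) <= \sum_u (cost q u (p u)).+1.
  by apply: leq_sum => u _; apply: auction_slack (gf u) (hp u).
under [X in _ <= X]eq_bigr do rewrite -addn1.
rewrite /cost !big_split /= !reidx sum_nat_const card_ord -!big_distrr /=.
move: (\sum_i D i (f i)) (\sum_i D i (p i)) (\sum_i q i) => a b c; nia.
Qed.

Lemma auction_spec s :
  tables s -> (forall j, s 5 j = 0) ->
  exists f : {perm V}, [/\ tables (run auction s), arr1 (run auction s) 4 (fun u => f u),
    forall u, tcol u = vcol (f u) &
    forall p : {perm V}, (forall u, tcol u = vcol (p u)) ->
      \sum_u D u (f u) <= \sum_u D u (p u)].
Proof.
move=> ht z5; rewrite /auction run_seq; set s1 := run auction_fill s.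
have ht1 : tables s1 by apply: tables_run.
have hr : auction_rep (fun=> None, fun=> 0) s1.
  split=> //; [exact: auction_fill_spec | by move=> x; rewrite /s1 run_frame].
have := @sweeps_converge _ auction_rep (fun gq => \sum_x gq.2 x) 13
  (EAdd (EMul nv (EAdd (EMul (EAdd nv (EConst 1)) nv) (EConst 1))) (EConst 1))
  (PFor 10 nv bid) (n * ((n + 1) * n + 1)) _ _ s1 isT _ _ auction_sweeps hr.
case.
- move=> gq s' k [h1 h2 h3 h4]; split=> //; exact: tables_update.
- move=> [g q] s' [_ _ _ hi]; rewrite -[X in X * _]card_ord -sum_nat_const.
  by apply: leq_sum => x _; apply: auction_price hi x.
- by rewrite /= (tables_n ht1) [X in _ < X]addn1.
move=> [g q] [h1 h2 h3 hi] /= st; set s2 := run _ s1 in h1 h2 h3 *.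
have gf u : g u = Some (odflt u (g u)) by case: (g u) (st u).
have inj : injective (fun u => odflt u (g u)).
  by move=> u v /= e; apply: (auction_inj hi (gf u)); rewrite e; apply: gf.
exists (perm inj); split=> //.
- by move=> u; rewrite h2 /= gf permE.
- by move=> u; rewrite permE; apply: (auction_color hi); apply: gf.
- by move=> p; apply: auction_optimal hi _; move=> u; rewrite permE -gf.
Qed.

End Auction.

(** * Swap sequences *)

(** The new transposition stands on the left because permutation products apply their left factor
    first, which matches the precomposition in [swap]. *)
Definition perm_after (T : finType) (sw : seq (T * T)) : {perm T} :=
  foldl (fun p e => (tperm e.1 e.2 * p)%g) 1%g sw.

Lemma perm_after_rcons (T : finType) (sw : seq (T * T)) e :
  perm_after (rcons sw e) = (tperm e.1 e.2 * perm_after sw)%g.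
Proof. by rewrite /perm_after foldl_rcons. Qed.

Lemma perm_after_cat (T : finType) (sw1 sw2 : seq (T * T)) :
  perm_after (sw1 ++ sw2) = (perm_after sw2 * perm_after sw1)%g.
Proof.
elim/last_ind: sw2 => [|sw2 e IH]; first by rewrite cats0 mul1g.
by rewrite -rcons_cat !perm_after_rcons IH mulgA.
Qed.

Lemma sum_split2 (T : finType) (F : T -> nat) (a b : T) :
  a != b -> \sum_v F v = F a + F b + \sum_(v | (v != a) && (v != b)) F v.
Proof.
by move=> ab; rewrite (bigD1 a) //= (bigD1 b) ?addnA // eq_sym.
Qed.

(* There and back along a path: [bounce d] runs through 0, ..., d - 1, ..., 0. *)
Definition bounce (d i : nat) : nat := i - ((i - (d - 1)) + (i - (d - 1))).

Definition route (T : Type) (x : nat -> T) (d : nat) : seq (T * T) :=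
  mkseq (fun i => (x (bounce d i), x (bounce d i).+1)) (2 * d - 1).

Lemma route_step (T : Type) (x : nat -> T) (d : nat) :
  route x d.+2 = (x 0, x 1) :: rcons (route (fun i => x i.+1) d.+1) (x 0, x 1).
Proof.
rewrite /route; apply: (@eq_from_nth _ (x 0, x 0)).
  by rewrite size_mkseq [RHS]/= size_rcons size_mkseq; lia.
rewrite size_mkseq => -[|i] hi.
  by rewrite nth_mkseq //; congr (x _, x _); rewrite /bounce; lia.
rewrite nth_mkseq //= nth_rcons size_mkseq; case: ifP => hi'.
  by rewrite nth_mkseq //; congr (x _, x _); rewrite /bounce; lia.
have -> : i == 2 * d.+1 - 1 by lia.
by congr (x _, x _); rewrite /bounce; lia.
Qed.

(** By [route_step] a route is a shorter route conjugated by its first swap, and conjugating the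
    transposition of [x 1] and the end by that of [x 0] and [x 1] moves [x 1] to [x 0]. *)
Lemma perm_after_route (T : finType) (x : nat -> T) (d : nat) :
  (forall i j, i <= d -> j <= d -> x i = x j -> i = j) ->
  perm_after (route x d) = tperm (x 0) (x d).
Proof.
(* For [d = 0] truncated subtraction makes the route empty, in accordance with a trivial
   transposition. *)
case: d => [|d] inj; first by rewrite tperm1.
elim: d x inj => [|d IH] x inj; first by rewrite /route /= /perm_after /= mulg1.
rewrite route_step -cat1s -cats1 !perm_after_cat IH; last first.
  by move=> i j hi hj /inj e; apply: succn_inj; apply: e; lia.
rewrite /perm_after /= !mulg1.
have := tpermJ (x 1) (x d.+2) (tperm (x 0) (x 1)).
rewrite tpermR tpermD; last 2 first.
- by apply/eqP => /inj; lia.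
- by apply/eqP => /inj; lia.
by rewrite /conjg tpermV mulgA.
Qed.

Section Swapping.

Variable I : cts_instance.
Notation G := (graph I).
Notation n := (nvert (graph I)).
Notation V := 'I_(nvert (graph I)).
Variables (D : V -> V -> nat) (N : V -> V -> V).
Hypothesis hopDN : hop_table D N.
Implicit Types (u v w x y h : V) (f g p : {perm V}) (sw : seq (V * V)).

Lemma placement_afterE sw v : placement_after sw v = perm_after sw v.
Proof.
elim/last_ind: sw v => [|sw e IH] v; first by rewrite perm1.
by rewrite /placement_after foldl_rcons perm_after_rcons permM -IH.
Qed.

(** * Total distance as a lower bound on the optimum *)

Definition total_dist g : nat := \sum_v D v (g v).

Lemma total_dist1 : total_dist 1%g = 0.
Proof. by apply: big1 => v _; rewrite perm1 (hop_refl hopDN). Qed.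

Lemma total_dist_le g : total_dist g <= n * n.
Proof.
rewrite -[X in X * _]card_ord -sum_nat_const.
by apply: leq_sum => u _; apply: hop_le hopDN _ _.
Qed.

Lemma adj_neq u v : adj u v -> u != v.
Proof. by apply: contraTneq => ->; rewrite adj_irr. Qed.

Lemma total_dist_swap g u v : u != v ->
  total_dist (tperm u v * g)%g + D u (g u) + D v (g v) =
  total_dist g + D u (g v) + D v (g u).
Proof.
move=> uv; rewrite /total_dist (sum_split2 _ uv) [X in _ = X + _ + _](sum_split2 _ uv).
rewrite !permM tpermL tpermR.
have key (a b c d S1 S2 : nat) : S1 = S2 -> a + b + S1 + c + d = c + d + S2 + a + b.
  lia.
by apply: key; apply: eq_bigr => w /andP[wu wv]; rewrite permM tpermD // eq_sym.
Qed.

(** A swap along an edge brings each of two tokens at most one step closer to its target. *)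
Lemma total_dist_lower f sw :
  all (fun e => @adj G e.1 e.2) sw ->
  total_dist f <= total_dist (perm_after sw * f)%g + 2 * size sw.
Proof.
elim/last_ind: sw => [|sw [u v] IH]; first by rewrite mul1g addn0.
rewrite all_rcons => /andP[/= uv /IH h]; rewrite perm_after_rcons size_rcons /= -mulgA.
move: h; set g := (perm_after sw * f)%g => h.
have vu : adj v u by rewrite adj_sym.
have key (t t' a b c d : nat) :
    t' + a + b = t + c + d -> a <= d.+1 -> b <= c.+1 -> t <= t' + 2 by lia.
apply: (leq_trans h); rewrite mulnS addnA leq_add2r.
exact: key (total_dist_swap g (adj_neq uv)) (hop_lip hopDN _ uv) (hop_lip hopDN _ vu).
Qed.

Definition optimal_target f : Prop :=
  (forall u, tcol u = vcol (f u)) /\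
  forall p : {perm V}, (forall u, tcol u = vcol (p u)) -> total_dist f <= total_dist p.

(** An optimal sequence itself defines a color-respecting assignment, the inverse of its
    permutation, whose total distance drops to 0 along the sequence. *)
Lemma total_dist_opt f m : optimal_target f -> is_min_length I m -> total_dist f <= 2 * m.
Proof.
move=> [_ hopt] [[sw [hadj hcol] <-] _].
apply: leq_trans (hopt (perm_after sw)^-1%g _) _.
  move=> u; have := hcol ((perm_after sw)^-1%g u).
  by rewrite placement_afterE permKV.
have := total_dist_lower (perm_after sw)^-1%g hadj.
by rewrite mulgV total_dist1.
Qed.

Lemma approx_solution_intro f sw (alpha : nat) :
  optimal_target f -> all (fun e => @adj G e.1 e.2) sw ->
  (perm_after sw * f = 1)%g -> size sw <= alpha * total_dist f ->
  approx_solution I (2 * alpha) (encode_swaps sw).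
Proof.
move=> hf hadj h1 hs; exists sw; split=> //.
  split=> // v; have [hc _] := hf; rewrite hc placement_afterE.
  by rewrite -permM h1 perm1.
move=> m /(total_dist_opt hf) h; apply: leq_trans hs _.
by rewrite (mulnC 2) -mulnA leq_mul2l h orbT.
Qed.

(** * Moves on trees *)

Definition tree_move g u v : bool :=
  [&& g u != u, v == N u (g u) & (g v == v) || (N v (g v) == u)].

Definition potential g : nat := total_dist g + #|porbits g|.

Lemma tree_move_adj g u v : tree_move g u v -> adj u v.
Proof.
by move=> /and3P[gu /eqP-> _]; apply: (hop_adj hopDN); rewrite eq_sym.
Qed.

(** If the token on [v] is at home, [v] is a cycle of its own: the swap merges two cycles, and the
    gain of one token pays for the loss of the other. If both tokens gain, the distance drops by 2
    while the number of cycles grows by at most 1. *)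
Lemma tree_move_potential g u v :
  tree_move g u v -> potential (tperm u v * g)%g < potential g.
Proof.
move=> hm; have uv := tree_move_adj hm; have huv := adj_neq uv.
have vu : adj v u by rewrite adj_sym.
have /and3P[gu /eqP ev hv] := hm.
have du : D u (g u) = (D v (g u)).+1.
  by rewrite ev (hop_dec hopDN) // eq_sym.
set g' : {perm V} := (tperm u v * g)%g; rewrite /potential.
have ht : total_dist g' + D u (g u) + D v (g v) = total_dist g + D u (g v) + D v (g u).
  exact: total_dist_swap.
have hc : #|porbits g'| + (u \notin porbit g v).*2 = #|porbits g| + 1.
  by have := porbits_mul_tperm g u v; rewrite /= huv.
move: (total_dist g') (total_dist g) #|porbits g'| #|porbits g| ht hc => t' t c' c ht.
case: (eqVneq (g v) v) hv => [gv _|gv /= /eqP hv].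
  have -> : u \notin porbit g v.
    apply/negP; rewrite -eq_porbit_mem => /eqP e.
    have : u \in porbit g v by rewrite -e porbit_id.
    move=> /porbitP[i hi]; move: huv; rewrite hi.
    have -> : (g ^+ i)%g v = v by elim: (i) => [|j IH]; rewrite ?perm1 // expgSr permM IH gv.
    by rewrite eqxx.
  by move=> /=; have := hop_lip hopDN v uv; move: ht; rewrite gv (hop_refl hopDN); lia.
have dv : D v (g v) = (D u (g v)).+1.
  by rewrite -hv (hop_dec hopDN) // eq_sym.
by case: (_ \notin _) => /=; lia.
Qed.

(** Let [F] send a vertex to the next hop of its token. Without a move, [F] maps misplaced tokens to
    misplaced tokens and never goes straight back, so its iterates close up into a graph cycle of
    length at least 3. *)
Lemma acyclic_no_move g :
  acyclic G -> (forall u v, ~~ tree_move g u v) -> g = 1%g.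
Proof.
move=> hac hno; apply/permP => u0; rewrite perm1; apply/eqP/negPn/negP => gu0.
pose F u := N u (g u).
have hF u : g u != u -> g (F u) != F u /\ F (F u) != u.
  by move=> gu; have := hno u (F u); rewrite /tree_move gu eqxx /= negb_or => /andP[].
have hi i : g (iter i F u0) != iter i F u0 by elim: i => //= i /hF[].
have [i hlt e] : exists2 i, i < fingraph.order F u0 &
    iter (fingraph.order F u0) F u0 = iter i F u0.
  by have /trajectP[i hlt e] := looping_order F u0; exists i.
(* The orbit of [u0] may have a tail; [y] is where it closes up, so the orbit of [y] is a cycle of
   [F]. *)
pose y := iter i F u0.
have cyc : fcycle F (fingraph.orbit F y).
  apply/(orbitPcycle 0 3); exists (fingraph.order F u0 - i).-1.
  by rewrite prednK ?subn_gt0 // /y -iterD subnK ?e // ltnW.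
have hy u : u \in fingraph.orbit F y -> g u != u.
  by move=> /trajectP[j _ ->]; rewrite /y -iterD.
(* Length 1 would be a loop of the graph, and length 2 would send [F y] back to [y]. *)
have size3 : 2 < size (fingraph.orbit F y).
  rewrite size_orbit.
  have [h1 h2] := hF _ (hy y (in_orbit F y)).
  have h0 : F y != y.
    have a : adj y (F y) by apply: (hop_adj hopDN); rewrite eq_sym hy ?in_orbit.
    by rewrite eq_sym adj_neq.
  have := iter_order_cycle cyc (in_orbit F y) (in_orbit F y).
  case: (fingraph.order F y) (fingraph.order_gt0 F y) => [|[|[|k]]] //= _ eq.
    by move/eqP: h0 => /(_ eq).
  by move/eqP: h2 => /(_ eq).
apply: (hac _ size3); rewrite /ucycle orbit_uniq andbT.
have := cyc; apply: (sub_in_cycle (P := [pred u | g u != u])); last first.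
  by apply/allP => u /hy.
move=> u v; rewrite !inE => gu _ /eqP <-; apply: (hop_adj hopDN).
by rewrite eq_sym.
Qed.

(** * Transpositions along shortest paths *)

Definition hops y h (i : nat) : V := iter i (fun x => N x h) y.

Lemma hops_dist y h i : i <= D y h -> D (hops y h i) h = D y h - i.
Proof.
elim: i => [|i IH] hi; first by rewrite subn0.
have e := IH (ltnW hi); have ne : hops y h i != h.
  by apply/eqP => e'; move: e; rewrite e' (hop_refl hopDN); lia.
by have := hop_dec hopDN ne; rewrite e /=; lia.
Qed.

Lemma hops_adj y h i : i < D y h -> adj (hops y h i) (hops y h i.+1).
Proof.
move=> hi; apply: (hop_adj hopDN); apply/eqP => e.
by have := hops_dist (ltnW hi); rewrite e (hop_refl hopDN); lia.
Qed.

Definition transposition_swaps y h : seq (V * V) := route (hops y h) (D y h).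

Lemma transposition_swaps_adj y h :
  all (fun e => @adj G e.1 e.2) (transposition_swaps y h).
Proof.
apply/allP => e /(nthP (y, y))[i]; rewrite size_mkseq => hi <-.
by rewrite nth_mkseq //=; apply: hops_adj; rewrite /bounce; lia.
Qed.

(** Distances to [h] decrease by 1 along the hops, so the vertices are distinct and the last one is
    [h]. *)
Lemma perm_after_transposition y h :
  perm_after (transposition_swaps y h) = tperm y h.
Proof.
rewrite perm_after_route.
  congr (tperm _ _); apply: (hop_eq hopDN).
  by rewrite hops_dist // subnn.
move=> i j hi hj e; have := hops_dist hi; rewrite e hops_dist //; lia.
Qed.

Definition pending h g : nat := \sum_(u | u != h) D u (g u).

Lemma pending_fixed h g : g h = h -> pending h g = total_dist g.
Proof.
by move=> gh; rewrite /total_dist (bigD1 h) //= gh (hop_refl hopDN).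
Qed.

Lemma pending_le h g : pending h g <= total_dist g.
Proof. by rewrite /total_dist (bigD1 h) //= leq_addl. Qed.

(** The token on [y] reaches its target [h], and the exempted token moves from [h] to [y], so
    exactly the distance [D y h] is paid off. *)
Lemma pending_step g y h : g y = h ->
  pending y (tperm y h * g)%g + D y h = pending h g.
Proof.
move=> gy; case: (eqVneq y h) => [e|yh].
  by rewrite -e tperm1 mul1g (hop_refl hopDN) addn0.
rewrite /pending (bigD1 h) 1?eq_sym //= [RHS](bigD1 y) //= gy.
rewrite permM tpermR gy (hop_refl hopDN) add0n addnC; congr (_ + _).
rewrite (eq_bigl (fun u => (u != h) && (u != y))); last by move=> u; rewrite andbC.
by apply: eq_bigr => u /andP[uh uy]; rewrite permM tpermD // eq_sym.
Qed.

End Swapping.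

(** * The two swapping phases *)

Definition emit : prog :=
  PSeq (PPut 1 (EAdd (cell 1) (EConst 1)) (cell 7))
  (PSeq (PPut 1 (EAdd (cell 1) (EConst 2)) (cell 8))
  (PSeq (PPut 1 (EConst 0) (EAdd (cell 1) (EConst 2)))
  (PSeq (PPut 9 (EConst 0) (EGet 4 (cell 7)))
  (PSeq (PPut 4 (cell 7) (EGet 4 (cell 8)))
        (PPut 4 (cell 8) (cell 9)))))).

Definition e_neq (e1 e2 : expr) : expr := EAdd (ESub e1 e2) (ESub e2 e1).
Arguments e_neq : simpl never.

Lemma eval_neq (s : store) (e1 e2 : expr) :
  (eval s (e_neq e1 e2) != 0) = (eval s e1 != eval s e2).
Proof. by rewrite /e_neq /=; case: eqP => h; lia. Qed.

Definition tree_try : prog :=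
  PSeq (PPut 7 (EConst 0) (cell 10))
  (PSeq (PPut 8 (EConst 0) (hop (cell 10) (EGet 4 (cell 10))))
    (PWhen (EMul (e_neq (EGet 4 (cell 10)) (cell 10))
              (EAdd (e_eq (EGet 4 (cell 8)) (cell 8))
                 (e_eq (hop (cell 8) (EGet 4 (cell 8))) (cell 10))))
       emit)).

(** Each effective pass emits a swap, which the potential pays for; the potential is at most [n * n]
    for the distances plus [n] for the cycles. *)
Definition tree_phase : prog :=
  PFor 13 (EAdd (EAdd (EMul nv nv) nv) (EConst 1)) (PFor 10 nv tree_try).

Definition find_try : prog :=
  PWhen (e_eq (EGet 4 (cell 11)) (cell 15)) (PPut 16 (EConst 0) (cell 11)).

Definition find_source : prog := PFor 11 nv find_try.

Definition path_extend : prog :=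
  PPut 17 (EAdd (cell 12) (EConst 1)) (hop (EGet 17 (cell 12)) (cell 15)).

Definition path_fill : prog :=
  PSeq (PPut 17 (EConst 0) (cell 16)) (PFor 12 nv path_extend).

Notation gap := (dist (cell 16) (cell 15)).
Notation bounce_expr :=
  (ESub (cell 12) (EAdd (ESub (cell 12) (ESub gap (EConst 1)))
                        (ESub (cell 12) (ESub gap (EConst 1))))).

Definition transpose_step : prog :=
  PWhen (e_lt (cell 12) (ESub (EMul (EConst 2) gap) (EConst 1)))
    (PSeq (PPut 7 (EConst 0) (EGet 17 bounce_expr))
    (PSeq (PPut 8 (EConst 0) (EGet 17 (EAdd bounce_expr (EConst 1))))
       emit)).

(** The bound must be static, so it covers the longest possible route; the guard of [transpose_step]
    makes surplus turns idle. *)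
Definition transpose : prog := PFor 12 (EMul (EConst 2) nv) transpose_step.

Definition cycle_step : prog :=
  PSeq find_source (PSeq path_fill (PSeq transpose (PPut 15 (EConst 0) (cell 16)))).

(** No permutation cycle has more than [n] vertices. Once the carried token is at home, it is its
    own source at distance 0, and surplus turns emit nothing. *)
Definition cycle_fix : prog :=
  PSeq (PPut 15 (EConst 0) (cell 10)) (PFor 13 nv cycle_step).

Definition general_phase : prog := PFor 10 nv cycle_fix.

Section Phases.

Variable I : cts_instance.
Notation G := (graph I).
Notation n := (nvert (graph I)).
Notation V := 'I_(nvert (graph I)).
Variables (D : V -> V -> nat) (N : V -> V -> V).
Hypothesis hopDN : hop_table D N.
Variable f : {perm V}.
Implicit Types (s : store) (u v w x y h c : V) (g : {perm V}) (sw : seq (V * V)).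

(** The permutation still to be realised after [sw]: it sends each vertex to the target of the token
    now on it. *)
Definition target sw : {perm V} := (perm_after sw * f)%g.

Lemma target_rcons sw u v : target (rcons sw (u, v)) = (tperm u v * target sw)%g.
Proof. by rewrite /target perm_after_rcons mulgA. Qed.

Record swap_rep sw s : Prop := SwapRep {
  rep_tables : tables D N s;
  rep_output : output s = encode_swaps sw;
  rep_adj : all (fun e => @adj G e.1 e.2) sw;
  rep_target : arr1 s 4 (fun v => target sw v)
}.

Lemma swap_rep_frame sw s s' :
  (forall a j, a \in [:: 0; 1; 2; 3; 4] -> s' a j = s a j) ->
  swap_rep sw s -> swap_rep sw s'.
Proof.
move=> h [h1 h2 h3 h4]; split=> //.
- apply: tables_frame h1 => a j ha; apply: h.
  by move: ha; rewrite !inE => /or3P[] ->; rewrite ?orbT.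
- by rewrite -h2 /output h //; apply: eq_mkseq => i; rewrite h.
- by apply: arr1_frame h4 => j; apply: h.
Qed.

Lemma swap_rep_run sw (p : prog) s :
  [&& ~~ writes p 0, ~~ writes p 1, ~~ writes p 2, ~~ writes p 3 & ~~ writes p 4] ->
  swap_rep sw s -> swap_rep sw (run p s).
Proof.
move=> /and5P[h0 h1 h2 h3 h4]; apply: swap_rep_frame => a j.
by rewrite !inE => /or4P[| | |/orP[]] /eqP->; rewrite run_frame.
Qed.

Lemma swap_rep_update sw s a i k :
  a \notin [:: 0; 1; 2; 3; 4] -> swap_rep sw s -> swap_rep sw (update s a i k).
Proof.
move=> ha; apply: swap_rep_frame => b j hb; rewrite updateE.
by case: eqP => [e|//]; move: hb; rewrite e (negbTE ha).
Qed.

Lemma encode_swaps_rcons sw u v :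
  encode_swaps (rcons sw (u, v)) = encode_swaps sw ++ [:: val u; val v].
Proof. by rewrite /encode_swaps map_rcons flatten_rcons. Qed.

Lemma emit_spec sw s u v :
  swap_rep sw s -> s 7 0 = u -> s 8 0 = v -> adj u v ->
  swap_rep (rcons sw (u, v)) (run emit s).
Proof.
move=> [h1 h2 h3 h4] su sv uv; split.
- by apply: tables_run.
- have E j : run emit s 1 j = if j == 0 then (s 1 0).+2 else
      if j == (s 1 0).+2 then val v else if j == (s 1 0).+1 then val u else s 1 j.
    rewrite /emit !run_seq !run_put /=.
    by do 4!rewrite ?updateE ?addn1 ?addn2 /=; rewrite su sv.
  rewrite encode_swaps_rcons -h2 /output E /= !mkseqS -!cats1 -catA !E /=.
  rewrite !eqSS !eqxx eqn_leq ltnn andbF; congr (_ ++ _).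
  apply/eq_in_map => i; rewrite mem_iota => /andP[_ hi].
  by rewrite E /= !eqSS !ltn_eqF // ltnW.
- by rewrite all_rcons uv.
- move=> x; rewrite target_rcons permM /emit !run_seq !run_put /=.
  do 4!rewrite ?updateE /=; rewrite su sv !val_eqE !h4.
  by case: tpermP => [->|->|/eqP/negbTE-> /eqP/negbTE->]; rewrite ?eqxx //; case: eqP => [->|].
Qed.

Definition tree_rep sw s : Prop :=
  swap_rep sw s /\ size sw + potential D (target sw) <= potential D f.

Lemma tree_try_sweeps u :
  sweeps (fun sw s => tree_rep sw s /\ s 10 0 = u) size tree_try
    (fun sw => ~~ tree_move N (target sw) u (N u (target sw u))).
Proof.
move=> sw s [[hr hp] su]; have [h1 h2 h3 h4] := hr.
have [hi hD hN] := h1; have sn := tables_n h1.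
rewrite /tree_try !run_seq !run_put run_when.
set s1 := update s 7 _ _; set s2 := update s1 8 _ _.
have e2 : s2 8 0 = N u (target sw u).
  by rewrite /s2 updateE /= /s1 !updateE /= su sn h4 hN.
have f2 a j : a \notin [:: 7; 8] -> s2 a j = s a j.
  rewrite !inE negb_or => /andP[/negbTE a7 /negbTE a8].
  by rewrite /s2 updateE a8 /s1 updateE a7.
have r2 : swap_rep sw s2 by do 2!(apply: swap_rep_update => //).
set v := N u (target sw u) in e2 *.
have -> : (eval s2 (EMul (e_neq (EGet 4 (cell 10)) (cell 10))
              (EAdd (e_eq (EGet 4 (cell 8)) (cell 8))
                 (e_eq (hop (cell 8) (EGet 4 (cell 8))) (cell 10)))) != 0) =
    tree_move N (target sw) u v.
  rewrite eval_and eval_or eval_neq !eval_eq /= e2 !f2 // su sn !h4 hN !val_eqE.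
  by rewrite /tree_move -/v eqxx.
case: ifP => hm; last first.
  by left.
right; split=> //; exists (rcons sw (u, v)); last by rewrite size_rcons.
split; last by rewrite run_frame ?f2.
split.
  by apply: emit_spec => //; apply: (tree_move_adj hopDN hm).
rewrite size_rcons target_rcons; apply: leq_trans hp.
by rewrite addSn -addnS leq_add2l; apply: (tree_move_potential hopDN hm).
Qed.

Lemma card_porbits_le g : #|porbits g| <= n.
Proof. by rewrite -[X in _ <= X]card_ord; apply: leq_imset_card. Qed.

Lemma card_porbits1 : #|porbits (1%g : {perm V})| = n.
Proof.
rewrite /porbits card_imset ?card_ord // => x y e.
have /porbitP[i ->] : x \in porbit 1%g y by rewrite -e porbit_id.
by rewrite expg1n perm1.
Qed.

Lemma tree_phase_spec s :
  acyclic G -> swap_rep [::] s ->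
  exists sw, [/\ swap_rep sw (run tree_phase s), target sw = 1%g &
    size sw <= total_dist D f].
Proof.
move=> hac hr; have sn := tables_n (rep_tables hr).
have hr0 : tree_rep [::] s by split=> //; rewrite /target mul1g.
have hsw : sweeps tree_rep size (PFor 10 nv tree_try) (fun sw =>
    forall k, k < n -> forall u, k = u ->
    ~~ tree_move N (target sw) u (N u (target sw u))).
  apply: sweeps_for => [//|||k hk].
  - by move=> sw s' k [h1 h2]; split=> //; apply: swap_rep_update.
  - by move=> sw s' [/rep_tables/tables_n].
  move=> sw s' hs; have [[h1 h2]|[h1 h2]] := @tree_try_sweeps (Ordinal hk) sw s' hs.
    by left; split=> // u eu; have -> : u = Ordinal hk by apply: val_inj.
  by right; split=> // h3; apply: h1; apply: h3.
have := @sweeps_converge _ tree_rep size 13 (EAdd (EAdd (EMul nv nv) nv) (EConst 1))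
  (PFor 10 nv tree_try) (n * n + n) _ _ s isT _ _ hsw hr0.
case.
- by move=> sw s' k [h1 h2]; split=> //; apply: swap_rep_update.
- move=> sw s' [_ h]; apply: (leq_trans (leq_addr _ _)); apply: (leq_trans h).
  by apply: leq_add; [apply: total_dist_le hopDN _ | apply: card_porbits_le].
- by rewrite /= sn addn1.
move=> sw [h1 h2] st; exists sw.
have e1 : target sw = 1%g.
  apply: (acyclic_no_move hopDN hac) => u v; apply/negP => hm.
  have ev : v = N u (target sw u) by move: hm => /and3P[_ /eqP].
  by have := st u (ltn_ord u) u erefl; rewrite -ev hm.
(* The final potential is [n], since the identity has [n] cycles and distance 0. The initial number
   of cycles is at most [n], so only the total distance remains as a bound. *)
split=> //; move: h2; rewrite e1 /potential card_porbits1 (total_dist1 hopDN).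
by have := card_porbits_le f; lia.
Qed.

Lemma find_source_spec s g y :
  s 0 1 = n -> arr1 s 4 (fun v => g v) -> s 15 0 = g y ->
  run find_source s 16 0 = y.
Proof.
move=> sn h4 s15; have en : eval s nv = n := sn.
have := @run_for 11 nv find_try s (fun k s' => y < k -> s' 16 0 = y) isT.
rewrite -/find_source en; apply => //.
move=> k s' hk ik fr IH; rewrite tick_neq // /find_try run_when eval_eq run_put /= ik.
have -> : s' 4 k = g (Ordinal hk) by rewrite fr // -h4.
rewrite (fr 15) // s15 val_eqE (inj_eq perm_inj).
case: eqP => [<- _|ne]; first by rewrite updateE.
rewrite ltnS leq_eqVlt => /orP[/eqP e|]; last exact: IH.
by case: ne; apply: val_inj.
Qed.

Lemma path_fill_spec s y h :
  tables D N s -> s 16 0 = y -> s 15 0 = h ->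
  forall i, i <= n -> run path_fill s 17 i = hops N y h i.
Proof.
move=> ht s16 s15 i hi; rewrite /path_fill run_seq run_put.
set s1 := update s 17 _ _; have [hin _ hN] := ht.
have sn : s1 0 1 = n by rewrite /s1 updateE (tables_n ht).
have en : eval s1 nv = n := sn.
have := @run_for 12 nv path_extend s1
  (fun k s' => forall i, i <= k -> s' 17 i = hops N y h i) isT.
rewrite en; apply=> //.
  by move=> [|j] //= _; rewrite /s1 !updateE /= s16.
move=> k s' hk ik fr IH j hj; rewrite tick_neq // /path_extend run_put /= updateE /= ik addn1.
case: eqP => [->|hne]; last by apply: IH; lia.
by rewrite (IH k) // !(fr 15, fr 0, fr 3) // sn /s1 !updateE /= s15 hN.
Qed.

Lemma transpose_spec sw s y h :
  swap_rep sw s -> s 16 0 = y -> s 15 0 = h ->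
  (forall i, i <= n -> s 17 i = hops N y h i) ->
  swap_rep (sw ++ transposition_swaps D N y h) (run transpose s).
Proof.
move=> hr s16 s15 s17; have sn := tables_n (rep_tables hr).
have en : eval s (EMul (EConst 2) nv) = 2 * n by rewrite /= sn.
set r := transposition_swaps D N y h.
have szr : size r = 2 * D y h - 1 by rewrite size_mkseq.
have dn := hop_le hopDN y h.
have := @run_for 12 (EMul (EConst 2) nv) transpose_step s
  (fun k s' => swap_rep (sw ++ take k r) s') isT.
rewrite -/transpose en => H.
have -> : sw ++ r = sw ++ take (2 * n) r by rewrite take_oversize // szr; lia.
apply: H; first by rewrite take0 cats0; apply: swap_rep_update.
move=> k s' hk ik fr IH; apply: swap_rep_update => //.
have [_ hD _] := rep_tables IH; have sn' := tables_n (rep_tables IH).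
rewrite /transpose_step run_when eval_lt !run_seq !run_put.
set d := dist _ _; have ed : eval s' d = D y h.
  by rewrite /d /= !(fr 16, fr 15) // s16 s15 sn' hD.
have e12 : eval s' (cell 12) = k := ik.
set b := ESub _ (EAdd _ _); have eb : eval s' b = bounce (D y h) k.
  by rewrite /b /bounce -ed -e12.
have -> : eval s' (ESub (EMul (EConst 2) d) (EConst 1)) = 2 * D y h - 1 by rewrite -ed.
rewrite e12; case: ifP => hlt; last first.
  rewrite take_oversize; last by rewrite szr; lia.
  by rewrite take_oversize // in IH; rewrite szr; lia.
pose e0 := (y, y).
have hb : (bounce (D y h) k).+1 <= n by rewrite /bounce; lia.
rewrite (take_nth e0) ?szr // -rcons_cat nth_mkseq //.
set s1 := update s' 7 _ _.
have s1E a j : a != 7 -> s1 a j = s' a j by move=> /negbTE ha; rewrite /s1 updateE ha.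
have eb1 : eval s1 b = bounce (D y h) k by rewrite -eb /b /= !s1E.
apply: emit_spec.
- by do 2!(apply: swap_rep_update => //).
- rewrite updateE /= /s1 updateE [_ && _]/=.
  have -> : eval s' (EGet 17 b) = s' 17 (bounce (D y h) k) by rewrite -eb.
  by rewrite fr // s17 // ltnW.
- rewrite updateE [_ && _]/=.
  have -> : eval s1 (EGet 17 (EAdd b (EConst 1))) = s' 17 (bounce (D y h) k).+1.
    by rewrite -(s1E 17) // -eb1 /= addn1.
  by rewrite fr // s17.
- have := transposition_swaps_adj hopDN y h.
  move=> /allP/(_ (nth e0 r k)); rewrite mem_nth ?szr // => /(_ isT).
  by rewrite nth_mkseq.
Qed.

Lemma target_transposition sw y h :
  target (sw ++ transposition_swaps D N y h) = (tperm y h * target sw)%g.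
Proof. by rewrite /target perm_after_cat (perm_after_transposition hopDN) mulgA. Qed.

Definition fixed g : {set V} := [set u | g u == u].

(* The token on [h], which started on [c], is carried backwards along its
   permutation cycle; its own distance is not paid for. *)
Record cycle_inv (j : nat) c h sw s : Prop := CycleInv {
  cycle_rep : swap_rep sw s;
  cycle_hole : s 15 0 = h;
  cycle_size : size sw + 2 * pending D h (target sw) <= 2 * total_dist D f;
  cycle_done : forall u, u < c -> target sw u = u;
  cycle_start : h = c /\ j = 0 \/ target sw c = c;
  cycle_fixed : j <= #|fixed (target sw)| \/ target sw h = h
}.

(** If one of [y], [h] were fixed, injectivity would give [y = h] and the transposition would be
    trivial. *)
Lemma tperm_fix g y h u : g y = h -> g u = u -> (tperm y h * g)%g u = u.
Proof.
move=> gy gu; rewrite permM; case: tpermP => [e|e|//].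
  by move: gu; rewrite e gy => eh; rewrite eh gy eh.
by rewrite gy e.
Qed.

(** The hole moves from [h] to the vertex [y] whose token wants [h]. Unless [y = h], this makes [h]
    a new fixed point and keeps the old ones, so [n] steps close the cycle. *)
Lemma cycle_step_spec j c h sw s :
  cycle_inv j c h sw s ->
  exists h' sw', cycle_inv j.+1 c h' sw' (run cycle_step s).
Proof.
move=> [hr s15 hs hd hc hf]; set g := target sw in hs hd hc hf.
pose y := (g^-1)%g h; have gy : g y = h by rewrite permKV.
have sn := tables_n (rep_tables hr).
rewrite /cycle_step !run_seq.
set s1 := run find_source s; have r1 : swap_rep sw s1 by apply: swap_rep_run.
have s1y : s1 16 0 = y by apply: (find_source_spec sn (rep_target hr)); rewrite s15 gy.
have s1h : s1 15 0 = h by rewrite /s1 run_frame.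
set s2 := run path_fill s1; have r2 : swap_rep sw s2 by apply: swap_rep_run.
have s2p : forall i, i <= n -> s2 17 i = hops N y h i.
  by apply: path_fill_spec => //; apply: rep_tables r1.
have s2y : s2 16 0 = y by rewrite /s2 run_frame.
have s2h : s2 15 0 = h by rewrite /s2 run_frame.
have r3 := transpose_spec r2 s2y s2h s2p; set s3 := run transpose s2 in r3 *.
have s3y : s3 16 0 = y by rewrite /s3 run_frame.
exists y, (sw ++ transposition_swaps D N y h).
have gh : (tperm y h * g)%g h = h by rewrite permM tpermR gy.
split; rewrite ?target_transposition -/g.
- by rewrite run_put; apply: swap_rep_update.
- by rewrite run_put updateE /= s3y.
- have := pending_step hopDN gy; rewrite size_cat size_mkseq.
  move: (pending _ _ _) (pending _ _ _) hs => a b; lia.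
- by move=> u hu; apply: tperm_fix gy (hd u hu).
- right; case: hc => [[<- _]|hc]; first by [].
  exact: tperm_fix.
- case: (eqVneq y h) => [e|yh]; first by right; rewrite e tperm1 mul1g -{1}e gy.
  left; case: hf => [hf|gh']; last by move: yh; rewrite -(inj_eq (@perm_inj _ g)) gy gh' eqxx.
  apply: (leq_ltn_trans hf); apply: proper_card; apply/properP; split.
    by apply/subsetP => u; rewrite !inE => /eqP gu; apply/eqP; apply: tperm_fix.
  exists h; rewrite !inE ?gh ?eqxx //.
  by rewrite -{2}gy (inj_eq perm_inj) eq_sym.
Qed.

Lemma cycle_fix_spec c sw s :
  swap_rep sw s -> s 10 0 = c ->
  size sw + 2 * total_dist D (target sw) <= 2 * total_dist D f ->
  (forall u, u < c -> target sw u = u) ->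
  exists sw', [/\ swap_rep sw' (run cycle_fix s),
    size sw' + 2 * total_dist D (target sw') <= 2 * total_dist D f &
    forall u, u <= c -> target sw' u = u].
Proof.
move=> hr s10 hs hd; rewrite /cycle_fix run_seq run_put.
set s1 := update s 15 _ _; have sn := tables_n (rep_tables hr).
have sn1 : s1 0 1 = n by rewrite /s1 updateE.
have en : eval s1 nv = n := sn1.
have : exists h sw', cycle_inv n c h sw' (run (PFor 13 nv cycle_step) s1).
  have := @run_for 13 nv cycle_step s1 (fun j s' => exists h sw', cycle_inv j c h sw' s') isT.
  rewrite en; apply.
    exists c, sw; split=> //; [by do 2!(apply: swap_rep_update => //) | | by left | by left].
    by apply: leq_trans hs; rewrite leq_add2l leq_mul2l pending_le.
  move=> j s' hj ij fr [h [sw' /cycle_step_spec[h' [sw2 [i1 i2 i3 i4 i5 i6]]]]].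
  by exists h', sw2; split=> //; apply: swap_rep_update.
move=> [h [sw' [i1 i2 i3 i4 i5 i6]]]; exists sw'.
have gh : target sw' h = h.
  (* With at least [n] fixed vertices, all are fixed, the hole included; then [pending] is again the
     full total distance. *)
  case: i6 => // hn; have : fixed (target sw') = setT.
    by apply/eqP; rewrite eqEcard subsetT cardsT card_ord.
  by move=> /setP/(_ h); rewrite !inE => /eqP.
split=> //; first by rewrite -(pending_fixed hopDN gh).
move=> u; rewrite leq_eqVlt => /orP[/eqP/val_inj->|]; last exact: i4.
(* The initial alternative would force [n = 0], but [c] is a vertex. *)
by case: i5 => // -[_ n0]; have := ltn_ord c; rewrite [X in _ < X]n0.
Qed.

Lemma general_phase_spec s :
  swap_rep [::] s ->
  exists sw, [/\ swap_rep sw (run general_phase s), target sw = 1%g &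
    size sw <= 2 * total_dist D f].
Proof.
move=> hr; have sn := tables_n (rep_tables hr); have en : eval s nv = n := sn.
have [sw [h1 h2 h3]] : exists sw, [/\ swap_rep sw (run general_phase s),
    size sw + 2 * total_dist D (target sw) <= 2 * total_dist D f &
    forall u, u < n -> target sw u = u].
  have := @run_for 10 nv cycle_fix s (fun k s' => exists sw, [/\ swap_rep sw s',
    size sw + 2 * total_dist D (target sw) <= 2 * total_dist D f &
    forall u, u < k -> target sw u = u]) isT.
  rewrite -/general_phase en; apply.
    by exists [::]; split=> //; [apply: swap_rep_update | rewrite /target mul1g].
  move=> k s' hk ik fr [sw [i1 i2 i3]].
  have [sw' [j1 j2 j3]] := @cycle_fix_spec (Ordinal hk) sw s' i1 ik i2 i3.
  by exists sw'; split=> //; apply: swap_rep_update.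
have e1 : target sw = 1%g by apply/permP => u; rewrite perm1 h3.
by exists sw; split=> //; move: h2; rewrite e1 (total_dist1 hopDN); lia.
Qed.

End Phases.

(** * Reading the encoded input and assembling the algorithms *)

Lemma nth_allpairs (S T R : Type) (F : S -> T -> R) (s : seq S) (t : seq T)
    (x0 : S) (y0 : T) (z0 : R) (i j : nat) :
  i < size s -> j < size t ->
  nth z0 [seq F x y | x <- s, y <- t] (i * size t + j) = F (nth x0 s i) (nth y0 t j).
Proof.
elim: s i => [|x s IH] [|i] //= hi hj; rewrite nth_cat size_map.
  by rewrite mul0n hj (nth_map y0).
rewrite mulSn -addnA ltnNge leq_addr /= addKn; exact: IH.
Qed.

Lemma init_input_rep (I : cts_instance) : input_rep I (init_store (encode_instance I)).
Proof.
pose n := nvert (graph I); pose V := 'I_n.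
have sE : size (enum V) = n by rewrite size_enum_ord.
have sA (F : V -> V -> nat) : size [seq F u v | u <- enum V, v <- enum V] = n * n.
  by rewrite size_allpairs sE.
split=> [//|u v|x|u]; rewrite /init_store /= ?add2n ?add0n /=.
- have h : u * n + v < n * n.
    have := ltn_ord u; have := ltn_ord v; rewrite -/n; nia.
  rewrite nth_cat sA h; have -> : u * nvert (graph I) + v = u * size (enum V) + v.
    by rewrite sE.
  rewrite (nth_allpairs _ u v) ?sE ?ltn_ord //.
  by rewrite !nth_ord_enum.
- rewrite nth_cat sA ltnNge leq_addr /= addKn nth_cat size_map sE ltn_ord.
  by rewrite (nth_map x) ?sE ?ltn_ord // nth_ord_enum.
- rewrite nth_cat sA -addnA ltnNge leq_addr /= addKn nth_cat size_map sE.
  by rewrite ltnNge leq_addr /= addKn (nth_map u) ?sE ?ltn_ord // nth_ord_enum.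
Qed.

Lemma encode_instance_size (I : cts_instance) :
  nth 0 (encode_instance I) 0 <= size (encode_instance I).
Proof.
have e : size (enum 'I_(nvert (graph I))) = nvert (graph I) := size_enum_ord _.
rewrite /= !size_cat size_map; apply: leqW; apply: (leq_trans _ (leq_addl _ _)).
by apply: (leq_trans _ (leq_addr _ _)); rewrite -[X in X <= _]e.
Qed.

Lemma setup_spec (I : cts_instance) :
  let s := run auction (run dist_prog (init_store (encode_instance I))) in
  exists D N (f : {perm 'I_(nvert (graph I))}),
    [/\ hop_table D N, optimal_target D f & swap_rep D N f [::] s].
Proof.
set s0 := init_store _; have hi : input_rep I s0 by apply: init_input_rep.
have z a j : a != 0 -> s0 a j = 0 by rewrite /s0 /init_store => /negbTE->.
have [|D [N [h1 h2 h3 hop]]] := dist_prog_spec hi; first by move=> j; apply: z.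
have [||f [t1 t2 t3 t4]] := auction_spec hop (s := run dist_prog s0).
- by split.
- by move=> j; rewrite run_frame // z.
exists D, N, f; split=> //; split=> //.
  by rewrite /output !run_frame // z.
by move=> v; rewrite t2 /target mul1g.
Qed.

Theorem theorem2 :
  poly_time_approx 4 (fun _ : sgraph => True) /\ poly_time_approx 2 is_tree.
Proof.
split.
- exists (compile (PSeq (PSeq dist_prog auction) general_phase)).
  apply: poly_time_run => // I _; split; first exact: encode_instance_size.
  rewrite !run_seq; have [D [N [f [hop hf hr]]]] := setup_spec I.
  have [sw [r1 r2 r3]] := general_phase_spec hop hr.
  rewrite (rep_output r1).
  exact: (approx_solution_intro hop (alpha := 2) hf (rep_adj r1) r2 r3).
- exists (compile (PSeq (PSeq dist_prog auction) tree_phase)).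
  apply: poly_time_run => // I [_ hac]; split; first exact: encode_instance_size.
  rewrite !run_seq; have [D [N [f [hop hf hr]]]] := setup_spec I.
  have [sw [r1 r2 r3]] := tree_phase_spec hop hac hr.
  rewrite (rep_output r1).
  apply: (approx_solution_intro hop (alpha := 1) hf (rep_adj r1) r2).
  by rewrite mul1n.
Qed.
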